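(* Let $n\ge 2$, $1<p<\infty$ and $q=p/(p-1)$. Let $g\in\mathcal L^p([0,1]^n)$, with marginals $g_i(\xi_i):=\int_{[0,1]^{n-1}} g(\xi)\,d\xi_i^c$, $1\le i\le n$. Then the system of integral equations $$\int_{[0,1]^{n-1}} \operatorname{sign}\Big(\frac1n\sum_{j=1}^n\Phi_j(\xi_j)\Big)\Big|\frac1n\sum_{j=1}^n\Phi_j(\xi_j)\Big|^{\frac1{p-1}}\,d\xi_i^c=g_i(\xi_i)\quad\text{for a.e. }\xi_i\in[0,1],\quad 1\le i\le n,$$ together with the constraints $$\int_0^1\Phi_i(\xi_i)\,d\xi_i=0,\qquad 2\le i\le n,$$ has a unique solution $(\Phi_1,\dots,\Phi_n)$ with $\Phi_i\in\mathcal L^q([0,1])$ for $1\le i\le n$ (unique up to a.e. equality). Moreover, setting $$\overline\Phi(\xi):=\frac1n\sum_{i=1}^n\Phi_i(\xi_i),\qquad \xi\in[0,1]^n,$$ one has $$\int_{[0,1]^n}|g(\xi)|^p\,d\xi\ \ge\ \int_{[0,1]^n}|\overline\Phi(\xi)|^{\frac{p}{p-1}}\,d\xi .$$ This estimate is sharp: equality holds if and only if $$g(\xi)=\operatorname{sign}\big(\overline\Phi(\xi)\big)\,\big|\overline\Phi(\xi)\big|^{\frac1{p-1}}\quad\text{for a.e. }\xi\in[0,1]^n.$$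
   Context: $\mathcal L^r([0,1]^n)$ denotes the space of (equivalence classes modulo a.e. equality of) real-valued Lebesgue-measurable functions $f$ on $[0,1]^n$ with $\|f\|_r:=(\int_{[0,1]^n}|f(\xi)|^r\,d\xi)^{1/r}<\infty$. For $\xi=(\xi_1,\dots,\xi_n)$ and $1\le i\le n$, $\xi_i^c:=(\xi_1,\dots,\xi_{i-1},\xi_{i+1},\dots,\xi_n)$ is the vector $\xi$ with the $i$-th coordinate omitted, and $\int f(\xi)\,d\xi_i^c$ denotes integration over all coordinates in $[0,1]$ except the $i$-th, giving a function of $\xi_i$. $\operatorname{sign}(t)$ is the sign of the real number $t$ ($\operatorname{sign}(0)=0$). *)

(* Defs.v *)
From HB Require Import structures.
From mathcomp Require Import all_boot all_order all_algebra.
From mathcomp Require Import all_classical all_reals all_analysis.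

Set Implicit Arguments.
Unset Strict Implicit.
Unset Printing Implicit Defensive.
Import Order.TTheory GRing.Theory Num.Theory.
Import numFieldNormedType.Exports.

Local Open Scope classical_set_scope.
Local Open Scope ring_scope.

Section product_measure_tuple.
Context d (T : measurableType d) (R : realType).

Definition cons_pair (n : nat) (x : T * n.-tuple T) : n.+1.-tuple T :=
  [the n.+1.-tuple T of x.1 :: x.2].

Lemma measurable_cons_pair n : measurable_fun setT (@cons_pair n).
Proof. exact: measurable_cons. Qed.

HB.instance Definition _ n :=
  isMeasurableFun.Build _ _ _ _ (@cons_pair n) (@measurable_cons_pair n).

(* P \x ... \x P (n factors), carried by the tuple type *)
Fixpoint tuple_power (P : probability T R) (n : nat) :
    probability (n.-tuple T) R :=
  match n with
  | 0%N => \d_ [tuple]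
  | n'.+1 => distribution (P \x tuple_power P n')%E (@cons_pair n')
  end.

End product_measure_tuple.

Section unit_cube.
Context (R : realType).

Definition lebesgue01 : set (measurableTypeR R) -> \bar R :=
  mrestr (@lebesgue_measure R) (@measurable_itv R `[0, 1]).

HB.instance Definition _ := Measure.on lebesgue01.

Lemma lebesgue01_setT : lebesgue01 setT = 1%E.
Proof.
rewrite /lebesgue01 /mrestr setTI lebesgue_measure_itv/= lte_fin ltr01.
by rewrite oppr0 adde0.
Qed.

HB.instance Definition _ :=
  Measure_isProbability.Build _ _ _ lebesgue01 lebesgue01_setT.

(* Functions on [0,1]^n are represented by functions on R^n taken modulo
   equality almost everywhere for this measure, which is concentrated on
   [0,1]^n. Measurability is for the Borel sigma-algebra, on which Lebesgue
   measure is defined in the library; every class of Lebesgue-measurable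
   functions modulo a.e. equality has a Borel representative. *)
Definition lebesgue_cube (n : nat) :
    probability (n.-tuple (measurableTypeR R)) R :=
  tuple_power lebesgue01 n.

End unit_cube.

(* The n-tuple with i-th coordinate t and whose other coordinates are, in
   order, those of y. *)
Definition insert_coord (T : Type) (n : nat) (i : 'I_n) (t : T)
    (y : n.-1.-tuple T) : n.-tuple T :=
  [tuple if unlift i j is Some k then tnth y k else t | j < n].

(* int_{[0,1]^(n-1)} F(xi) d xi_i^c, as a function of t = xi_i *)
Definition marginal (R : realType) (n : nat) (F : n.-tuple R -> R) (i : 'I_n)
    (t : R) : \bar R :=
  (\int[lebesgue_cube R n.-1]_y (F (insert_coord i t y))%:E)%E.

Definition average (R : realType) (n : nat) (Phi : 'I_n -> R -> R)
    (xi : n.-tuple R) : R :=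
  n%:R^-1 * \sum_(j < n) Phi j (tnth xi j).

Definition signed_power (R : realType) (a x : R) : R :=
  Num.sg x * `|x| `^ a.

(* Coordinates are numbered from 0, so the normalization concerns i > 0. *)
Definition is_solution (R : realType) (n : nat) (p q : R)
    (g : n.-tuple R -> R) (Phi : 'I_n -> R -> R) : Prop :=
  [/\ (forall i : 'I_n, Phi i \in Lfun (@lebesgue01 R) q%:E),
      (forall i : 'I_n, {ae @lebesgue01 R, forall t,
         marginal (fun xi => signed_power (p - 1)^-1 (average Phi xi)) i t =
         marginal g i t})
    & (forall i : 'I_n, (0 < i)%N ->
         (\int[@lebesgue01 R]_t (Phi i t)%:E = 0)%E)].

(* Main.v *)
(* Duality. With q the conjugate exponent of p, let h range over the averages
   of functions Phi_i in L^q of one variable each, and minimize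
     int |g|^p / p + |h|^q / q - g h,
   whose integrand, the energy, is nonnegative by Young's inequality. Uniform
   convexity of |.|^q makes minimizing sequences Cauchy in L^1; normalized
   Phi_i are controlled in L^1 by their average, so along a fast minimizing
   sequence each Phi_i converges a.e. and Fatou's lemma yields a minimizer. The
   vanishing of the first variation in the directions 1_A(xi_i) says that
   sign(h) |h|^(q - 1) and g have the same i-th marginal for every i.
   Conversely, equality of the marginals of F and G amounts to
   int F h = int G h for all averages h. Strict monotonicity of
   sign(x) |x|^(q - 1) then gives uniqueness, and for a solution the minimal
   energy is (int |g|^p - int |h|^q) / p; it vanishes only in the equality
   case of Young's inequality, that is, if g = sign(h) |h|^(q - 1) a.e. *)

Require Import Defs.
From mathcomp Require Import all_boot all_order all_algebra.
From mathcomp Require Import all_classical all_reals all_analysis.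
From mathcomp Require Import measurable_realfun ring lra zify.

Set Implicit Arguments.
Unset Strict Implicit.
Unset Printing Implicit Defensive.
Import Order.TTheory GRing.Theory Num.Theory.
Import numFieldNormedType.Exports.

Local Open Scope classical_set_scope.
Local Open Scope ring_scope.

(** * Signed powers and Young's inequality *)

Section signed_power.
Context (R : realType).
Implicit Types a x y : R.

Lemma signed_power0 a : signed_power a (0 : R) = 0.
Proof. by rewrite /signed_power sgr0 mul0r. Qed.

Lemma signed_powerN a x : signed_power a (- x) = - signed_power a x.
Proof. by rewrite /signed_power sgrN normrN mulNr. Qed.

Lemma ge0_signed_power a x : a != 0 -> 0 <= x -> signed_power a x = x `^ a.
Proof.
move=> a0; rewrite le_eqVlt => /predU1P[<-|x0].
  by rewrite signed_power0 powR0.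
by rewrite /signed_power gtr0_sg// mul1r gtr0_norm.
Qed.

Lemma normr_signed_power a x : a != 0 -> `|signed_power a x| = `|x| `^ a.
Proof.
move=> a0; have [->|x0] := eqVneq x 0; first by rewrite signed_power0 !normr0 powR0.
by rewrite /signed_power normrM normr_sg x0 mul1r ger0_norm// powR_ge0.
Qed.

(** Sign and absolute value are recovered separately: the signed power keeps the sign, and the power
    with exponent a > 0 is injective on nonnegative reals. *)
Lemma signed_power_inj a : 0 < a -> injective (@signed_power R a).
Proof.
move=> a0 x y /[dup] xy /(congr1 Num.sg).
have sg z : Num.sg (signed_power a z) = Num.sg z.
  have [->|z0] := eqVneq z 0; first by rewrite signed_power0.
  rewrite /signed_power sgrM sgr_id (@gtr0_sg _ (_ `^ _)) ?mulr1//.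
  by rewrite powR_gt0// normr_gt0.
rewrite !sg => sxy.
have : `|signed_power a x| = `|signed_power a y| by rewrite xy.
rewrite !normr_signed_power ?gt_eqF// => /powR_injective nxy.
by rewrite (numEsg x) (numEsg y) sxy nxy// inE.
Qed.

Lemma measurable_signed_power a : measurable_fun setT (@signed_power R a).
Proof.
apply: measurable_funM.
  apply: nondecreasing_measurable => // x y xy.
  have [x0|x0|x0] := ltgtP x 0; have [y0|y0|y0] := ltgtP y 0;
    rewrite ?(ltr0_sg x0) ?(gtr0_sg x0) ?(ltr0_sg y0) ?(gtr0_sg y0);
    rewrite ?x0 ?y0 ?sgr0; lra.
exact: (measurableT_comp (measurable_powR a)).

Qed.

(** At positive points this is the differentiability of the real power, carried to negative points
    by oddness; at 0 the bound |y|^a < e amounts to |y| < e^(1/a). *)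
Lemma continuous_signed_power a : 0 < a -> continuous (@signed_power R a).
Proof.
move=> a0.
have pos x : 0 < x -> signed_power a y @[y --> x] --> signed_power a x.
  move=> x0; rewrite (ge0_signed_power (lt0r_neq0 a0) (ltW x0)).
  apply: (@cvg_trans _ ((y `^ a) @[y --> x])).
    apply: near_eq_cvg; near=> y; rewrite ge0_signed_power ?gt_eqF//.
    by rewrite ltW//; near: y; exact: lt_nbhsr.
  apply: (@differentiable_continuous _ _ _ x (@powR R ^~ a)); apply/derivable1_diffP.
  by apply: derivable_powR; rewrite in_itv/= x0.
move=> x; have [x0|x0|<-] := ltgtP 0 x.
- exact: pos.
- have -> : signed_power a = - (signed_power a \o -%R) :> (R -> R).
    by apply/funext => y /=; rewrite fctE/= signed_powerN opprK.
  apply: cvgN; apply: continuous_comp; first exact: opp_continuous.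
  by apply: pos; rewrite oppr_gt0.
- rewrite /continuous_at signed_power0; apply/cvgrPdist_lt => /= e e0; near=> y.
  rewrite sub0r normrN normr_signed_power ?gt_eqF//.
  have -> : e = (e `^ a^-1) `^ a by rewrite -powRrM mulVf ?gt_eqF// powRr1// ltW.
  rewrite gt0_ltr_powR ?nnegrE ?powR_ge0//.
  near: y; exists (e `^ a^-1) => /=; first exact: powR_gt0.
  by move=> y /=; rewrite sub0r normrN.
Unshelve. all: by end_near. Qed.

Lemma continuous_norm_powR a : 0 < a -> continuous (fun x : R => `|x| `^ a).
Proof.
move=> a0; have -> : (fun x => `|x| `^ a) = Num.norm \o signed_power a.
  by apply/funext => x /=; rewrite normr_signed_power ?gt_eqF.
move=> x; apply: continuous_comp; first exact: continuous_signed_power.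
exact: norm_continuous.
Qed.

End signed_power.

Section young.
Context (R : realType) (p q : R).
Hypotheses (p1 : 1 < p) (q1 : 1 < q) (pq : p^-1 + q^-1 = 1).
Implicit Types x y a b : R.

Let p0 : 0 < p. Proof. exact: lt_trans ltr01 p1. Qed.
Let q0 : 0 < q. Proof. exact: lt_trans ltr01 q1. Qed.
Let qB1 : 0 < q - 1. Proof. by rewrite subr_gt0. Qed.
Let qB1M : (q - 1) * p = q.
Proof.
have : (p^-1 + q^-1) * (p * q) = p * q by rewrite pq mul1r.
rewrite mulrDl mulrA mulVf ?gt_eqF// mul1r mulrCA mulVf ?gt_eqF//; lra.
Qed.

Lemma signed_powerMr x : signed_power (q - 1) x * x = `|x| `^ q.
Proof.
rewrite /signed_power mulrAC -normrEsg mulr_powRB1//.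
Qed.

Lemma powR_signed_power x : `|signed_power (q - 1) x| `^ p = `|x| `^ q.
Proof. by rewrite normr_signed_power ?gt_eqF// -powRrM qB1M. Qed.

Lemma young x y : x * y <= `|x| `^ p / p + `|y| `^ q / q.
Proof.
apply: (le_trans (ler_norm _)); rewrite normrM.
exact: conjugate_powR.
Qed.

(* Writing |x|^p = e^u and |y|^q = e^v, equality means that the convex
   function exp is affine between u and v, hence u = v. *)
Lemma young_eq x y : x * y = `|x| `^ p / p + `|y| `^ q / q ->
  x = signed_power (q - 1) y.
Proof.
move=> exy.
have xy0 : 0 <= x * y by rewrite exy addr_ge0// divr_ge0 ?powR_ge0// ltW.
have nxy : x * y = `|x| * `|y| by rewrite -normrM ger0_norm.
have [y0|y0] := eqVneq y 0.
  move: exy; rewrite y0 signed_power0 mulr0 normr0 powR0 ?gt_eqF// mul0r addr0.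
  move/esym/eqP; rewrite mulf_eq0 invr_eq0 (gt_eqF p0) orbF powR_eq0 normr_eq0.
  by case/andP => /eqP.
have [x0|x0] := eqVneq x 0.
  move: exy; rewrite x0 mul0r normr0 powR0 ?gt_eqF// mul0r add0r => /esym/eqP.
  by rewrite mulf_eq0 invr_eq0 (gt_eqF q0) orbF powR_eq0 normr_eq0 (negbTE y0).
have nx : 0 < `|x| by rewrite normr_gt0.
have ny : 0 < `|y| by rewrite normr_gt0.
pose u := p * ln `|x|; pose v := q * ln `|y|; pose w := u / p + v / q.
have eu : `|x| `^ p = expR u by rewrite /powR gt_eqF.
have ev : `|y| `^ q = expR v by rewrite /powR gt_eqF.
have ew : x * y = expR w.
  by rewrite nxy /w /u /v mulrAC mulfV ?gt_eqF// mul1r mulrAC mulfV ?gt_eqF//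
    mul1r expRD !lnK ?posrE.
have uw : u = w.
  apply/eqP/negPn/negP => uw.
  (* The tangent to exp at w lies strictly below exp at u and weakly below it at v; averaged with
     weights 1/p and 1/q, the tangent values give exp w itself, which contradicts the assumed
     equality. *)
  have h1 : expR w * (1 + (u - w)) < expR u.
    rewrite -[u in ltRHS](subrK w) [in ltRHS]expRD mulrC ltr_pM2r ?expR_gt0//.
    by rewrite expR_gt1Dx// subr_eq0.
  have h2 : expR w * (1 + (v - w)) <= expR v.
    rewrite -[v in leRHS](subrK w) [in leRHS]expRD mulrC ler_pM2r ?expR_gt0//.
    exact: expR_ge1Dx.
  have h3 : expR w * (1 + (u - w)) / p + expR w * (1 + (v - w)) / q = expR w.
    have -> : expR w * (1 + (u - w)) / p + expR w * (1 + (v - w)) / q =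
      expR w * ((1 - w) * (p^-1 + q^-1) + (u / p + v / q)) by ring.
    by rewrite pq mulr1 -/w subrK mulr1.
  have : expR w < expR u / p + expR v / q.
    by rewrite -{1}h3 ltr_leD// ?ltr_pM2r ?ler_pM2r ?invr_gt0.
  by rewrite -ew -eu -ev exy ltxx.
have uv : u = v.
  have : u * (p^-1 + q^-1) = u / p + v / q by rewrite pq mulr1.
  rewrite mulrDr => /addrI /(congr1 ( *%R^~ q)).
  by rewrite -!mulrA mulVf ?gt_eqF// !mulr1.
have xyn : `|x| = `|y| `^ (q - 1).
  apply: (@powR_injective _ p) => //; rewrite ?inE//= ?nnegrE ?powR_ge0//.
  by rewrite -powRrM qB1M eu ev uv.
rewrite /signed_power -xyn.
suff -> : Num.sg y = Num.sg x by rewrite -numEsg.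
have : 0 < x * y by rewrite ew expR_gt0.
by move/gtr0_sg; rewrite sgrM; case: (sgrP x); case: (sgrP y) => //; lra.
Qed.

(** The Bregman divergence of |.|^q / q, whose derivative is [signed_power (q - 1)]. *)
Definition tangent_gap x y :=
  `|y| `^ q / q - `|x| `^ q / q - signed_power (q - 1) x * (y - x).

(** Seen as the defect in Young's inequality for the pair ([signed_power (q - 1) x], y), the
    divergence gets its sign from [young] and its zeros from [young_eq]. *)
Let tangent_gapE x y : tangent_gap x y =
  `|signed_power (q - 1) x| `^ p / p + `|y| `^ q / q - signed_power (q - 1) x * y.
Proof.
rewrite powR_signed_power /tangent_gap mulrBr signed_powerMr.
have -> : p^-1 = 1 - q^-1 by rewrite -pq addrK.
by ring.
Qed.

Lemma tangent_gap_ge0 x y : 0 <= tangent_gap x y.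
Proof. by rewrite tangent_gapE subr_ge0 young. Qed.

Lemma tangent_gap_eq0 x y : tangent_gap x y = 0 -> x = y.
Proof.
rewrite tangent_gapE => /eqP; rewrite subr_eq0 => /eqP /esym /young_eq.
exact: signed_power_inj.
Qed.

(** Symmetrizing the divergence produces the monotonicity product, so that strict monotonicity
    reduces to [tangent_gap_eq0]. *)
Let tangent_gapD x y : tangent_gap x y + tangent_gap y x =
  (signed_power (q - 1) x - signed_power (q - 1) y) * (x - y).
Proof. by rewrite /tangent_gap; ring. Qed.

Lemma signed_power_mono x y :
  0 <= (signed_power (q - 1) x - signed_power (q - 1) y) * (x - y).
Proof. by rewrite -tangent_gapD addr_ge0// tangent_gap_ge0. Qed.

Lemma signed_power_strict_mono x y :
  (signed_power (q - 1) x - signed_power (q - 1) y) * (x - y) = 0 -> x = y.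
Proof.
rewrite -tangent_gapD => /eqP.
rewrite paddr_eq0 ?tangent_gap_ge0// => /andP[/eqP + _].
exact: tangent_gap_eq0.
Qed.

(** The Jensen defect of |.|^q at a midpoint, which quantifies its strict convexity. *)
Definition midpoint_gap x y :=
  (`|x| `^ q + `|y| `^ q) / 2 - `|(x + y) / 2| `^ q.

(** The first-order terms at the midpoint cancel, because x and y lie symmetrically about it. *)
Let midpoint_gapE x y : midpoint_gap x y =
  q / 2 * (tangent_gap ((x + y) / 2) x + tangent_gap ((x + y) / 2) y).
Proof.
rewrite /midpoint_gap /tangent_gap.
by field; rewrite gt_eqF.
Qed.

Lemma midpoint_gap_ge0 x y : 0 <= midpoint_gap x y.
Proof.
rewrite midpoint_gapE mulr_ge0 ?divr_ge0 ?(ltW q0)//.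
by rewrite addr_ge0// tangent_gap_ge0.
Qed.

Lemma midpoint_gap_gt0 x y : x != y -> 0 < midpoint_gap x y.
Proof.
move=> xy; rewrite lt_neqAle midpoint_gap_ge0 andbT eq_sym.
apply: contra xy; rewrite midpoint_gapE mulf_eq0 mulf_eq0 gt_eqF//= invr_eq0.
rewrite pnatr_eq0/= paddr_eq0 ?tangent_gap_ge0// => /andP[/eqP + /eqP].
by move=> /tangent_gap_eq0 + /tangent_gap_eq0 => xE yE; apply/eqP; lra.
Qed.

Let midpoint_gapC x y : midpoint_gap x y = midpoint_gap y x.
Proof. by rewrite /midpoint_gap [`|x| `^ q + _]addrC [x + y]addrC. Qed.

Let midpoint_gapZ a x y :
  midpoint_gap (a * x) (a * y) = `|a| `^ q * midpoint_gap x y.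
Proof. by rewrite /midpoint_gap -mulrDr -mulrA !normrM !powRM//; ring. Qed.

Let continuous_midpoint_gap y : continuous (midpoint_gap ^~ y).
Proof.
have cpow := @continuous_norm_powR R _ q0.
move=> x; apply: cvgB.
  by apply: cvgMl; apply: cvgD; [exact: cpow|exact: cvg_cst].
apply: (@continuous_comp _ _ _ (fun x => (x + y) / 2) (fun x => `|x| `^ q)).
  by apply: cvgMl; apply: cvgD; [exact: cvg_id|exact: cvg_cst].
exact: cpow.
Qed.

(* By homogeneity it suffices to treat y = 1 and |x| <= 1, where compactness
   bounds the gap from below away from x = y. *)
Lemma midpoint_gap_coercive (e : R) : 0 < e -> exists2 C : R, 0 <= C &
  forall x y, `|x - y| <= e * (1 + `|x| `^ q + `|y| `^ q) + C * midpoint_gap x y.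
Proof.
move=> e0.
(* c is the minimum of the gap over t in [-1, 1 - e]; for e > 2 this interval is empty and any
   positive c serves. *)
have [c c0 hc] : exists2 c, 0 < c &
    forall t, `|t| <= 1 -> e < `|t - 1| -> c <= midpoint_gap t 1.
  have [e2|e2] := leP (-1) (1 - e); last first.
    exists 1 => // t; rewrite ler_norml => /andP[t1 t2].
    by rewrite ler0_norm ?subr_le0//; lra.
  have [c cI hc] := EVT_min e2 (continuous_subspaceT (@continuous_midpoint_gap 1)).
  exists (midpoint_gap c 1).
    apply: midpoint_gap_gt0; move: cI; rewrite in_itv/= => /andP[_ ce].
    by rewrite lt_eqF//; lra.
  move=> t; rewrite ler_norml => /andP[t1 t2].
  rewrite ler0_norm ?subr_le0// => et; apply: hc.
  by rewrite in_itv/= t1/=; lra.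
(* Chosen so that K |y| <= |y|^q once |y| >= e / 2. *)
pose K := (e / 2) `^ (q - 1).
have K0 : 0 < K by rewrite powR_gt0// divr_gt0.
exists (2 / K / c); first by rewrite !divr_ge0// ltW.
move=> x y; wlog xy : x y / `|x| <= `|y|.
  move=> wh; have [/wh//|/ltW/wh] := leP `|x| `|y|.
  by rewrite distrC midpoint_gapC [1 + _ + _]addrAC.
have [y0|y0] := eqVneq y 0.
  have -> : x = y by move: xy; rewrite y0 normr0 normr_le0 => /eqP ->.
  rewrite subrr normr0 addr_ge0// mulr_ge0 ?midpoint_gap_ge0 ?(ltW e0)//.
  by rewrite !divr_ge0// ltW.
have ny : 0 < `|y| by rewrite normr_gt0.
have xE : x = y * (x / y) by rewrite mulrC divfK.
have gapE : midpoint_gap x y = `|y| `^ q * midpoint_gap (x / y) 1.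
  by rewrite -midpoint_gapZ mulr1 -xE.
have dE : `|x - y| = `|y| * `|x / y - 1|.
  by rewrite -normrM mulrBr mulr1 -xE.
have yq0 : 0 <= `|y| `^ q by exact: powR_ge0.
have xq0 : 0 <= `|x| `^ q by exact: powR_ge0.
have gap0 : 0 <= midpoint_gap (x / y) 1 by exact: midpoint_gap_ge0.
have t1 : `|x / y| <= 1 by rewrite normrM normfV ler_pdivrMr// mul1r.
(* Three cases. If |x/y - 1| <= e, then |y| <= 1 + |y|^q suffices. If 2 |y| <= e, then |x - y| <= 2
   |y| is already at most e. Otherwise the gap is at least c |y|^q >= c K |y|. *)
rewrite dE gapE; have [te|et] := leP `|x / y - 1| e.
  have y1 : `|y| <= 1 + `|y| `^ q.
    have [y1|y1] := leP `|y| 1; first by rewrite ler_wpDr.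
    by rewrite ler_wpDl// le1r_powR// ltW.
  have : `|y| * `|x / y - 1| <= e * (1 + `|x| `^ q + `|y| `^ q).
    by rewrite mulrC ler_pM//; lra.
  by move/le_trans; apply; rewrite ler_wpDr// !mulr_ge0// invr_ge0 ltW.
have {et}cgap := hc _ t1 et.
have t2 : `|x / y - 1| <= 2.
  by rewrite (le_trans (ler_normB _ _))// normr1; lra.
have step : `|y| * `|x / y - 1| <= 2 * `|y| by rewrite mulrC ler_wpM2r.
have [ye|ey] := leP (2 * `|y|) e.
  apply: (le_trans step); apply: (le_trans ye).
  rewrite ler_wpDr// ?mulr_ge0// ?invr_ge0 ?(ltW c0) ?(ltW K0)//.
  by rewrite ler_peMr ?(ltW e0)//; lra.
apply: (le_trans step); rewrite ler_wpDl//.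
  by rewrite mulr_ge0 ?(ltW e0)//; lra.
have Ky : `|y| * K <= `|y| `^ q.
  rewrite -(@mulr_powRB1 _ `|y| q)// ler_wpM2l//.
  by apply: ge0_ler_powR; rewrite ?(ltW qB1)// ?nnegrE//; lra.
have -> : 2 / K / c * (`|y| `^ q * midpoint_gap (x / y) 1) =
  2 * ((`|y| `^ q / K) * (midpoint_gap (x / y) 1 / c)) by ring.
rewrite ler_wpM2l// -[leLHS]mulr1 ler_pM// ?ler_pdivlMr// ?mul1r//.
Qed.

End young.

(** * Fubini's theorem on powers of a probability space *)

Section insert_coord.
Context (T : Type).
Implicit Types (n : nat) (t : T).

Lemma tnth_insert_coord n (i : 'I_n) t (y : n.-1.-tuple T) :
  tnth (insert_coord i t y) i = t.
Proof. by rewrite tnth_mktuple unlift_none. Qed.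

Lemma tnth_insert_coord_lift n (i : 'I_n) t (y : n.-1.-tuple T) k :
  tnth (insert_coord i t y) (lift i k) = tnth y k.
Proof. by rewrite tnth_mktuple liftK. Qed.

End insert_coord.

Section insert_coord_cons.
Context d (T : measurableType d).
Implicit Types (n : nat) (t : T).

Lemma insert_coord0 n t (y : n.-tuple T) :
  insert_coord ord0 t y = cons_pair (t, y).
Proof.
apply: eq_from_tnth => j; case: (unliftP ord0 j) => [k|] ->.
  by rewrite tnth_insert_coord_lift tnthS.
by rewrite tnth_insert_coord tnth0.
Qed.

(** Insertion at a positive index commutes with prepending a head; this is the inductive step for
    integrating along an arbitrary coordinate. *)
Lemma insert_coord_lift n (i : 'I_n.+1) t u (y : n.-tuple T) :
  insert_coord (lift ord0 i) t (cons_pair (u, y)) =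
  cons_pair (u, insert_coord i t y).
Proof.
apply: eq_from_tnth => j; case: (unliftP ord0 j) => [k|] ->; last first.
  have e0 : ord0 = lift (lift ord0 i) (ord0 : 'I_n.+1) by apply/val_inj.
  by rewrite [X in tnth _ X = _]e0 tnth_insert_coord_lift !tnth0.
rewrite tnthS/=; case: (unliftP i k) => [l|] ->; last first.
  by rewrite !tnth_insert_coord.
have -> : lift ord0 (lift i l) = lift (lift ord0 i) (lift ord0 l : 'I_n.+1).
  by apply/val_inj => /=; rewrite /bump /= !add1n ltnS leqNgt; lia.
by rewrite !tnth_insert_coord_lift tnthS.
Qed.

Lemma measurable_insert_coord d' (X : measurableType d') n (i : 'I_n.+1)
    (f : X -> T) (g : X -> n.-tuple T) :
  measurable_fun setT f -> measurable_fun setT g ->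
  measurable_fun setT (fun x => insert_coord i (f x) (g x : n.+1.-1.-tuple T)).
Proof.
move=> mf mg; apply/measurable_fun_tnthP => j; case: (unliftP i j) => [k|] ->.
  rewrite (_ : _ \o _ = (@tnth _ T ^~ k) \o g).
    by apply: measurableT_comp => //; exact: measurable_tnth.
  by apply/funext => z /=; rewrite tnth_insert_coord_lift.
rewrite (_ : _ \o _ = f)//.
by apply/funext => z /=; rewrite tnth_insert_coord.
Qed.

End insert_coord_cons.

Section tuple_power_fubini.
Context d (T : measurableType d) (R : realType) (P : probability T R).
Local Open Scope ereal_scope.

Let ge0_integral_tuple_powerS n (f : n.+1.-tuple T -> \bar R) :
  measurable_fun setT f -> (forall x, 0 <= f x) ->
  \int[tuple_power P n.+1]_x f x =
  \int[P]_t \int[tuple_power P n]_y f (cons_pair (t, y)).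
Proof.
move=> mf f0.
rewrite /= ge0_integral_pushforward//= preimage_setT.
rewrite (@fubini_tonelli1 _ _ _ _ _ _ _ (f \o @cons_pair _ T n))//.
  exact: measurableT_comp.
by move=> z; exact: f0.
Qed.

(** By induction on n. The recursive definition of the measure only isolates the head u. For a later
    coordinate t, the induction hypothesis isolates t in the tail, Tonelli exchanges t and u, and u
    is put back as the head. *)
Lemma ge0_integral_tuple_power n (i : 'I_n.+1) (f : n.+1.-tuple T -> \bar R) :
  measurable_fun setT f -> (forall x, 0 <= f x) ->
  \int[tuple_power P n.+1]_x f x =
  \int[P]_t \int[tuple_power P n]_y f (insert_coord i t y).
Proof.
elim: n i f => [|n IHn] i f mf f0; rewrite (ge0_integral_tuple_powerS mf f0).
  by rewrite (ord1 i); under [RHS]eq_integral do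
    under eq_integral do rewrite insert_coord0.
case: (unliftP ord0 i) => [k|] ->; last first.
  by under [RHS]eq_integral do under eq_integral do rewrite insert_coord0.
pose g (z : (T * T) * n.-tuple T) :=
  f (cons_pair (z.1.2, insert_coord k z.1.1 z.2)).
have mg : measurable_fun setT g.
  apply: measurableT_comp => //.
  apply: measurable_cons.
    by apply: (measurableT_comp measurable_snd); exact: measurable_fst.
  apply: measurable_insert_coord => //.
  by apply: (measurableT_comp measurable_fst); exact: measurable_fst.
transitivity (\int[P]_u \int[P]_t \int[tuple_power P n]_y g ((t, u), y)).
  apply: eq_integral => u _; rewrite (IHn k (fun y => f (cons_pair (u, y))))//.
  apply: measurableT_comp => //.
  by apply: measurable_cons; [exact: measurable_cst|exact: measurable_id].
rewrite -(@fubini_tonelli _ _ _ _ _ P P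
  (fun z => \int[tuple_power P n]_y g (z, y)))//; last first.
- by move=> z; apply: integral_ge0 => y _; exact: f0.
- apply: (@measurable_fun_fubini_tonelli_F _ _ _ _ _ (tuple_power P n) g) => //.
  by move=> z; exact: f0.
apply: eq_integral => t _; apply/esym.
pose h (y : n.+1.-tuple T) := f (insert_coord (lift ord0 k) t y).
have mh : measurable_fun setT h.
  apply: measurableT_comp => //.
  by apply: measurable_insert_coord => //; exact: measurable_cst.
rewrite (ge0_integral_tuple_powerS mh (fun=> f0 _)).
apply: eq_integral => u _; apply: eq_integral => y _.
by rewrite /h insert_coord_lift.
Qed.

Lemma integrable_insert_coord n (i : 'I_n.+1) (f : n.+1.-tuple T -> \bar R) :
  (tuple_power P n.+1).-integrable setT f ->
  (P \x tuple_power P n).-integrable setT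
    (fun z => f (insert_coord i z.1 z.2)).
Proof.
move=> /integrableP[mf fi].
have mg : measurable_fun setT
    (fun z : T * n.-tuple T => f (insert_coord i z.1 z.2)).
  apply: measurableT_comp => //.
  by apply: measurable_insert_coord => //; exact: measurable_fst.
apply/integrable12ltyP => //.
rewrite -(ge0_integral_tuple_power i (f := fun x => `|f x|))//.
exact: measurableT_comp.
Qed.

(** Fubini turns the iterated integral into a product integral; both sides then split into positive
    and negative parts, to which the nonnegative case applies. *)
Lemma integral_tuple_power n (i : 'I_n.+1) (f : n.+1.-tuple T -> \bar R) :
  (tuple_power P n.+1).-integrable setT f ->
  \int[tuple_power P n.+1]_x f x =
  \int[P]_t \int[tuple_power P n]_y f (insert_coord i t y).
Proof.
move=> fi; have [mf _] := integrableP _ _ _ fi.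
have gi := integrable_insert_coord i fi.
have [mg _] := integrableP _ _ _ gi.
have mgp := measurable_funepos mg; have mgn := measurable_funeneg mg.
rewrite integralE !(ge0_integral_tuple_power i)//; last 2 first.
- exact: measurable_funeneg.
- exact: measurable_funepos.
rewrite (integral12_prod_meas1 gi) [RHS]integralE.
congr (_ - _).
- rewrite (@fubini_tonelli1 _ _ _ _ _ P (tuple_power P n) _ mgp
    (fun=> funepos_ge0 _ _)).
  by apply: eq_integral => t _; apply: eq_integral => y _; rewrite !funeposE.
- rewrite (@fubini_tonelli1 _ _ _ _ _ P (tuple_power P n) _ mgn
    (fun=> funeneg_ge0 _ _)).
  by apply: eq_integral => t _; apply: eq_integral => y _; rewrite !funenegE.
Qed.

(** Each coordinate has law P, since the remaining ones have total mass 1. *)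
Lemma ge0_integral_tnth n (i : 'I_n) (f : T -> \bar R) :
  measurable_fun setT f -> (forall x, 0 <= f x) ->
  \int[tuple_power P n]_x f (tnth x i) = \int[P]_t f t.
Proof.
case: n i => [[]//|n] i mf f0.
rewrite (ge0_integral_tuple_power i)//; last first.
  by apply: measurableT_comp => //; exact: measurable_tnth.
apply: eq_integral => t _.
under eq_integral do rewrite tnth_insert_coord.
by rewrite integral_cst// [X in _ * X]probability_setT mule1.
Qed.

Lemma integrable_tnth n (i : 'I_n) (f : T -> \bar R) :
  P.-integrable setT f ->
  (tuple_power P n).-integrable setT (fun x => f (tnth x i)).
Proof.
move=> /integrableP[mf fi]; apply/integrableP; split.
  by apply: measurableT_comp => //; exact: measurable_tnth.
rewrite (ge0_integral_tnth i (f := fun x => `|f x|))//.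
exact: measurableT_comp.
Qed.

Lemma integral_tnth n (i : 'I_n) (f : T -> \bar R) : measurable_fun setT f ->
  \int[tuple_power P n]_x f (tnth x i) = \int[P]_t f t.
Proof.
move=> mf; rewrite integralE [RHS]integralE; congr (_ - _).
  rewrite -(ge0_integral_tnth i (measurable_funepos mf))//.
  by apply: eq_integral => x _; rewrite !funeposE.
rewrite -(ge0_integral_tnth i (measurable_funeneg mf))//.
by apply: eq_integral => x _; rewrite !funenegE.
Qed.

(** A null set of P pulls back to a null set: the integral of its indicator is preserved. *)
Lemma ae_tnth n (i : 'I_n) (Q : T -> Prop) : {ae P, forall t, Q t} ->
  {ae tuple_power P n, forall x, Q (tnth x i)}.
Proof.
move=> [N [mN N0 QN]]; exists ((@tnth _ T ^~ i) @^-1` N); split.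
- by rewrite -[X in measurable X]setTI; exact: measurable_tnth.
- have mI : measurable ((@tnth _ T ^~ i) @^-1` N : set (n.-tuple T)).
    by rewrite -[X in measurable X]setTI; exact: measurable_tnth.
  rewrite -[X in tuple_power P n X]setIT -integral_indic//.
  rewrite (ge0_integral_tnth i (f := fun t => (\1_N t)%:E)).
  + by rewrite integral_indic// setIT.
  + exact/measurable_EFinP/measurable_indic.
  + by move=> t; rewrite lee_fin.
- by move=> x /=; exact: QN.
Qed.

End tuple_power_fubini.

(** The sum of all increments has integral at most C, so it is finite almost everywhere, and there
    the telescoping series converges absolutely. *)
Lemma ae_cvgn_fast d (T : measurableType d) (R : realType)
    (mu : {measure set T -> \bar R}) (f : nat -> T -> R) (C : R) :
  0 <= C -> (forall k, measurable_fun setT (f k)) ->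
  (forall k, (\int[mu]_x `|f k.+1 x - f k x|%:E <= (C / (2 ^ k.+1)%:R)%:E)%E) ->
  exists2 g : T -> R, measurable_fun setT g &
    {ae mu, forall x, f ^~ x @ \oo --> g x}.
Proof.
move=> C0 mf fC.
pose u k x : \bar R := `|f k.+1 x - f k x|%:E.
have mu_ k : measurable_fun setT (u k).
  apply/measurable_EFinP; apply: measurableT_comp => //.
  exact: measurable_funB.
have u0 k x : (0 <= u k x)%E by rewrite lee_fin.
have iu : mu.-integrable setT (fun x => \sum_(k <oo) u k x)%E.
  apply/integrableP; split.
    exact: ge0_emeasurable_sum.
  under eq_integral do rewrite gee0_abs ?nneseries_ge0//.
  rewrite integral_nneseries//; apply: le_lt_trans (ltry C).
  apply: le_trans (epsilon_trick0 xpredT C0).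
  by apply: lee_nneseries => [k _ _|k _]; [exact: integral_ge0|exact: fC].
(* The upper limit is measurable on the whole space; [fine] replaces infinite values, which occur
   only on a null set, by 0. *)
exists (fun x => fine (limn_esup (fun k => (f k x)%:E))).
  apply: (measurableT_comp (fine_measurable measurableT)).
  by apply: measurable_fun_limn_esup => k; exact/measurable_EFinP.
apply: filterS (integrable_ae measurableT iu) => x /(_ I) fin.
have cvs : cvgn [normed series (telescope (f ^~ x))].
  apply: nondecreasing_is_cvgn.
    by apply: nondecreasing_series => k _ _; exact: normr_ge0.
  exists (fine (\sum_(k <oo) u k x)%E) => _ [n _ <-].
  rewrite -lee_fin fineK//.
  apply: le_trans (@nneseries_lim_ge R (u ^~ x) xpredT 0 n (fun k _ _ => u0 k x)).
  by rewrite big_mkord sumEFin lee_fin -(big_mkord xpredT (fun k => `|f k.+1 x - f k x|)).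
have := normed_cvg cvs.
rewrite telescopeK => cv.
have cvf : cvgn (f ^~ x).
  have -> : f ^~ x = [sequence f n x - f 0%N x]_n + cst (f 0%N x).
    by apply/funext => n; rewrite !fctE subrK.
  by apply: is_cvgD; [exact: cv|exact: is_cvg_cst].
have cvfE : (f n x)%:E @[n --> \oo] --> (limn (f ^~ x))%:E.
  by apply: cvg_EFin => //; exact: nearW.
rewrite is_cvg_limn_esupE; last exact: cvgP cvfE.
by rewrite (cvg_lim _ cvfE).
Qed.

(** * The energy in the duality between L^p and L^q *)

Section real_integrable.
Context d (T : measurableType d) (R : realType).
Variable mu : probability T R.
Implicit Types f g h : T -> R.

Lemma integrable_funD f g : mu.-integrable setT (EFin \o f) ->
  mu.-integrable setT (EFin \o g) ->
  mu.-integrable setT (EFin \o (fun x => f x + g x)).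
Proof.
move=> fi gi; rewrite (_ : _ \o _ = (EFin \o f) \+ (EFin \o g))%E.
  exact: integrableD.
by apply/funext => x /=; rewrite EFinD.
Qed.

Lemma integrable_funB f g : mu.-integrable setT (EFin \o f) ->
  mu.-integrable setT (EFin \o g) ->
  mu.-integrable setT (EFin \o (fun x => f x - g x)).
Proof.
move=> fi gi; rewrite (_ : _ \o _ = (EFin \o f) \- (EFin \o g))%E.
  exact: integrableB.
by apply/funext => x /=; rewrite EFinB.
Qed.

Lemma integrable_funZ a f : mu.-integrable setT (EFin \o f) ->
  mu.-integrable setT (EFin \o (fun x => a * f x)).
Proof.
move=> fi; rewrite (_ : _ \o _ = (fun x => a%:E * (EFin \o f) x))%E.
  exact: integrableZl.
by apply/funext => x /=; rewrite EFinM.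
Qed.

Lemma integrable_fun_cst a : mu.-integrable setT (EFin \o (fun=> a)).
Proof. exact: finite_measure_integrable_cst. Qed.

Lemma integrable_fun_sum (I : Type) (s : seq I) (f : I -> T -> R) :
  (forall i, mu.-integrable setT (EFin \o f i)) ->
  mu.-integrable setT (EFin \o (fun x => \sum_(i <- s) f i x)).
Proof.
move=> fi; elim: s => [|i s IHs].
  under [X in _ \o X]funext do rewrite big_nil.
  exact: integrable_fun_cst.
under [X in _ \o X]funext do rewrite big_cons.
exact: integrable_funD.
Qed.

Lemma le_integrable_fun f g : measurable_fun setT f ->
  mu.-integrable setT (EFin \o g) -> (forall x, `|f x| <= g x) ->
  mu.-integrable setT (EFin \o f).
Proof.
move=> mf gi fg; apply: le_integrable gi => //; first exact/measurable_EFinP.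
move=> x _ /=; rewrite lee_fin.
exact: le_trans (fg x) (ler_norm _).
Qed.

Lemma Rintegral_EFin f : mu.-integrable setT (EFin \o f) ->
  (\int[mu]_x (f x)%:E = (\int[mu]_x f x)%R%:E)%E.
Proof. by move=> fi; rewrite /Rintegral fineK// integrable_fin_num. Qed.

Lemma Lfun_measurable r f : f \in Lfun mu r -> measurable_fun setT f.
Proof. by rewrite inE => /andP[/[!inE]]. Qed.

Lemma Lfun_powR_integrable r f : 1 <= r -> f \in Lfun mu r%:E ->
  mu.-integrable setT (EFin \o (fun x => `|f x| `^ r)).
Proof. exact: Lfun_integrable. Qed.

Lemma integrable_powR_Lfun r f : 1 <= r -> measurable_fun setT f ->
  mu.-integrable setT (EFin \o (fun x => `|f x| `^ r)) ->
  f \in Lfun mu r%:E.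
Proof.
move=> r1 mf /integrableP[_ fi].
rewrite inE; apply/andP; split; rewrite inE//=.
rewrite /finite_norm unlock /= poweR_lty//.
apply: le_lt_trans fi; rewrite le_eqVlt; apply/orP; left; apply/eqP.
by apply: eq_integral => x _ /=; rewrite (ger0_norm (powR_ge0 _ _)).
Qed.

Lemma measurable_norm_powR r f : measurable_fun setT f ->
  measurable_fun setT (fun x => `|f x| `^ r).
Proof.
move=> mf; apply: (measurableT_comp (measurable_powR r)).
exact: measurableT_comp.
Qed.

Lemma LfunD r f g : 1 <= r -> f \in Lfun mu r%:E -> g \in Lfun mu r%:E ->
  (fun x => f x + g x) \in Lfun mu r%:E.
Proof.
move=> r1; have r1E : (1 <= r%:E)%E by rewrite lee_fin.
exact: (Lfun_addr_closed mu r1E).2.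
Qed.

Lemma LfunZ r a f : 1 <= r -> f \in Lfun mu r%:E ->
  (fun x => a * f x) \in Lfun mu r%:E.
Proof.
move=> r1 fr; rewrite (_ : (fun x => _) = a \o* f); first exact: Lfun_scale.
by apply/funext => x /=; rewrite mulrC.
Qed.

Lemma LfunB r f g : 1 <= r -> f \in Lfun mu r%:E -> g \in Lfun mu r%:E ->
  (fun x => f x - g x) \in Lfun mu r%:E.
Proof.
move=> r1 fr gr; have := LfunD r1 fr (LfunZ (-1) r1 gr).
by under [X in X \in _ -> _]funext do rewrite mulN1r.
Qed.

Lemma Lfun_norm_le1 r f : 1 <= r -> measurable_fun setT f ->
  (forall x, `|f x| <= 1) -> f \in Lfun mu r%:E.
Proof.
move=> r1 mf f1; apply: integrable_powR_Lfun => //.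
apply: (@le_integrable_fun _ (fun=> 1)) => [||x].
- exact: measurable_norm_powR.
- exact: integrable_fun_cst.
- rewrite (ger0_norm (powR_ge0 _ _)) -[leRHS](congr1 (@^~ r) (powR1 R)).
  by apply: ge0_ler_powR; rewrite ?nnegrE// (le_trans ler01).
Qed.

Lemma Lfun_sum r (I : Type) (s : seq I) (f : I -> T -> R) : 1 <= r ->
  (forall i, f i \in Lfun mu r%:E) ->
  (fun x => \sum_(i <- s) f i x) \in Lfun mu r%:E.
Proof.
move=> r1 fr; elim: s => [|i s IHs].
  under [X in X \in _]funext do rewrite big_nil.
  exact: Lfun_cst.
under [X in X \in _]funext do rewrite big_cons.
exact: LfunD.
Qed.

End real_integrable.

Section energy.
Context (R : realType) (p q : R).
Hypotheses (p1 : 1 < p) (q1 : 1 < q) (pq : p^-1 + q^-1 = 1).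
Implicit Types x y z : R.

Let p0 : 0 < p. Proof. exact: lt_trans ltr01 p1. Qed.
Let q0 : 0 < q. Proof. exact: lt_trans ltr01 q1. Qed.

Definition energy x y := `|x| `^ p / p + `|y| `^ q / q - x * y.

Lemma energy_ge0 x y : 0 <= energy x y.
Proof. by rewrite subr_ge0 young. Qed.

Lemma energy_eq0 x y : energy x y = 0 -> x = signed_power (q - 1) y.
Proof.
by move=> /eqP; rewrite subr_eq0 => /eqP /esym; exact: young_eq.
Qed.

(** Young's inequality applied to (2 x) (y / 2) bounds x y while using up only the fraction 2^(-q)
    of |y|^q / q. The remaining part, c |y|^q, is controlled by the energy and |x|^p. *)
Lemma energy_coercive : exists2 K : R, 0 <= K &
  forall x y, `|y| `^ q <= K * (energy x y + `|x| `^ p).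
Proof.
pose c := (1 - 2^-1 `^ q) / q.
have c0 : 0 < c.
  rewrite divr_gt0// subr_gt0 -[ltRHS](congr1 (@^~ q) (powR1 R)).
  rewrite gt0_ltr_powR ?nnegrE//.
  by rewrite invf_lt1// ltr1n.
have t0 : 0 <= 2 `^ p :> R by exact: powR_ge0.
exists ((1 + 2 `^ p) / c) => [|x y].
  by rewrite divr_ge0 ?ltW// ltr_wpDr.
have xp0 : 0 <= `|x| `^ p by exact: powR_ge0.
have e0 := energy_ge0 x y.
have xy : x * y <= 2 `^ p * `|x| `^ p + 2^-1 `^ q * `|y| `^ q / q.
  have -> : x * y = (2 * x) * (2^-1 * y) by rewrite mulrACA mulfV// mul1r.
  apply: (le_trans (young p1 q1 pq _ _)); rewrite !normrM !powRM//.
  rewrite normfV ger0_norm// lerD2r ler_pdivrMr//.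
  by rewrite ler_peMr ?(ltW p1)// mulr_ge0.
have cy : c * `|y| `^ q <= energy x y + 2 `^ p * `|x| `^ p.
  have : 0 <= `|x| `^ p / p by rewrite divr_ge0// ltW.
  rewrite /energy /c; move: xy.
  move=> xy' h.
  have -> : (1 - 2^-1 `^ q) / q * `|y| `^ q =
    `|y| `^ q / q - 2^-1 `^ q * `|y| `^ q / q by ring.
  by lra.
rewrite mulrAC ler_pdivlMr// mulrC (le_trans cy)//.
move: (energy x y) e0 => E E0; rewrite -subr_ge0.
have -> : (1 + 2 `^ p) * (E + `|x| `^ p) - (E + 2 `^ p * `|x| `^ p) =
  `|x| `^ p + 2 `^ p * E by ring.
by rewrite addr_ge0// mulr_ge0.
Qed.

(** The product x y is affine in y, so the convexity defect comes from |.|^q / q alone. *)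
Lemma energy_midpoint x y z : energy x ((y + z) / 2) =
  (energy x y + energy x z) / 2 - q^-1 * midpoint_gap q y z.
Proof. by rewrite /energy /midpoint_gap; field; rewrite !gt_eqF. Qed.

End energy.

(** * Integrals of the energy: uniform convexity and first variation *)

Section Lp_duality.
Context d (T : measurableType d) (R : realType) (mu : probability T R).
Context (p q : R).
Hypotheses (p1 : 1 < p) (q1 : 1 < q) (pq : p^-1 + q^-1 = 1).
Implicit Types f g h k : T -> R.

Let q0 : 0 < q. Proof. exact: lt_trans ltr01 q1. Qed.
Let qB1 : 0 < q - 1. Proof. by rewrite subr_gt0. Qed.

(** The pointwise Young inequality gives an integrable majorant. *)
Lemma Lfun_mul_integrable f h : f \in Lfun mu p%:E -> h \in Lfun mu q%:E ->
  mu.-integrable setT (EFin \o (fun x => f x * h x)).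
Proof.
move=> fp hq; apply: (@le_integrable_fun _ _ _ _ _
    (fun x => p^-1 * `|f x| `^ p + q^-1 * `|h x| `^ q)).
- by apply: measurable_funM; [exact: Lfun_measurable fp|exact: Lfun_measurable hq].
- apply: integrable_funD; apply: integrable_funZ; apply: Lfun_powR_integrable => //;
    exact: ltW.
- move=> x; have := young p1 q1 pq `|f x| `|h x|.
  by rewrite !normr_id normrM ![_^-1 * _]mulrC.
Qed.

Lemma Lfun_signed_power h : h \in Lfun mu q%:E ->
  (fun x => signed_power (q - 1) (h x)) \in Lfun mu p%:E.
Proof.
move=> hq; apply: integrable_powR_Lfun; first exact: ltW.
  apply: (measurableT_comp (measurable_signed_power _)).
  exact: Lfun_measurable hq.
under [X in _ \o X]funext do rewrite (powR_signed_power p1 q1 pq).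
exact: Lfun_powR_integrable (ltW q1) hq.
Qed.

Lemma Lfun_integrable1 r f : 1 <= r -> f \in Lfun mu r%:E ->
  mu.-integrable setT (EFin \o f).
Proof.
move=> r1 fr; apply: (@le_integrable_fun _ _ _ _ _ (fun x => 1 + `|f x| `^ r)).
- exact: Lfun_measurable fr.
- by apply: integrable_funD; [exact: integrable_fun_cst|exact: Lfun_powR_integrable].
- move=> x; have [fx|fx] := leP `|f x| 1; first by rewrite ler_wpDr// powR_ge0.
  by rewrite ler_wpDl// le1r_powR// ltW.
Qed.

Lemma measurable_energy g h : measurable_fun setT g -> measurable_fun setT h ->
  measurable_fun setT (fun x => energy p q (g x) (h x)).
Proof.
move=> mg mh; apply: measurable_funB; last exact: measurable_funM.
by apply: measurable_funD; apply: measurable_funM; do ?exact: measurable_cst;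
  exact: measurable_norm_powR.
Qed.

Lemma energy_integrable g h : g \in Lfun mu p%:E -> h \in Lfun mu q%:E ->
  mu.-integrable setT (EFin \o (fun x => energy p q (g x) (h x))).
Proof.
move=> gp hq; apply: integrable_funB; last exact: Lfun_mul_integrable.
apply: integrable_funD.
  under [X in _ \o X]funext do rewrite mulrC.
  by apply: integrable_funZ; exact: Lfun_powR_integrable (ltW p1) gp.
under [X in _ \o X]funext do rewrite mulrC.
by apply: integrable_funZ; exact: Lfun_powR_integrable (ltW q1) hq.
Qed.

(** Coercivity bounds |h|^q by integrable functions. This serves for a limit of a minimizing
    sequence, of which only finite energy is known. *)
Lemma energy_integrable_Lfun g h : g \in Lfun mu p%:E -> measurable_fun setT h ->
  mu.-integrable setT (EFin \o (fun x => energy p q (g x) (h x))) ->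
  h \in Lfun mu q%:E.
Proof.
move=> gp mh ie; have [K K0 hK] := energy_coercive p1 q1 pq.
apply: integrable_powR_Lfun => //; first exact: ltW.
apply: (@le_integrable_fun _ _ _ _ _
    (fun x => K * (energy p q (g x) (h x) + `|g x| `^ p))).
- exact: measurable_norm_powR.
- apply: integrable_funZ; apply: integrable_funD => //.
  exact: Lfun_powR_integrable (ltW p1) gp.
- by move=> x; rewrite (ger0_norm (powR_ge0 _ _)).
Qed.

(* Uniform convexity: an L^1 form of the fact that minimizing sequences of the
   energy are Cauchy. *)
Lemma energy_L1_dist g (m e : R) : g \in Lfun mu p%:E -> 0 <= m -> 0 < e ->
  exists2 delta, 0 < delta &
    forall h k, h \in Lfun mu q%:E -> k \in Lfun mu q%:E ->
    m <= \int[mu]_x energy p q (g x) ((h x + k x) / 2) ->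
    \int[mu]_x energy p q (g x) (h x) <= m + delta ->
    \int[mu]_x energy p q (g x) (k x) <= m + delta ->
    \int[mu]_x `|h x - k x| <= e.
Proof.
move=> gp m0 e0; have [K K0 hK] := energy_coercive p1 q1 pq.
pose G := \int[mu]_x (`|g x| `^ p).
have G0 : 0 <= G by apply: Rintegral_ge0 => x _; exact: powR_ge0.
(* By coercivity, M bounds the integral of 1 + |h|^q + |k|^q when both energies are at most m + 1.
   Taking the parameter of [midpoint_gap_coercive] to be e / 2 / M makes that term contribute at
   most e / 2. *)
pose M := 1 + K * (2 * m + 2 + 2 * G).
have M0 : 0 < M by rewrite ltr_pwDl// mulr_ge0//; lra.
have eta0 : 0 < e / 2 / M by rewrite !divr_gt0.
have [C C0 hC] := midpoint_gap_coercive p1 q1 pq eta0.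
have [eta etaE] : exists eta, eta = e / 2 / M by exists (e / 2 / M).
rewrite -etaE in eta0 hC.
have Cq0 : 0 <= C * q by rewrite mulr_ge0// ltW.
(* The bound 1 keeps the energies below m + 1; the other bound makes the gap term, at most C q
   delta, no larger than e / 2. Adding 1 to C q avoids a zero denominator. *)
exists (Num.min 1 (e / 2 / (C * q + 1))).
  by rewrite lt_min ltr01/= !divr_gt0// ltr_wpDl.
set delta := Num.min _ _ => h k hq kq mid hm km.
have d1 : delta <= 1 by rewrite /delta ge_min lexx.
have d2 : C * q * delta <= e / 2.
  have d3 : delta <= e / 2 / (C * q + 1) by rewrite /delta ge_min lexx orbT.
  apply: (@le_trans _ _ ((C * q + 1) * (e / 2 / (C * q + 1)))).
    apply: ler_pM => //; first by rewrite /delta le_min ler01/= !divr_ge0 ?ltW// ltr_wpDl.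
    by rewrite lerDl.
  by rewrite mulrC divfK// gt_eqF// ltr_wpDl.
have ih := energy_integrable gp hq; have ik := energy_integrable gp kq.
have hkq : (fun x => (h x + k x) / 2) \in Lfun mu q%:E.
  under [X in X \in _]funext do rewrite mulrC.
  by apply: LfunZ; [exact: ltW|apply: LfunD => //; exact: ltW].
have ihk := energy_integrable gp hkq.
have ig := Lfun_powR_integrable (ltW p1) gp.
(* The bound of [midpoint_gap_coercive], with |h|^q and |k|^q estimated by coercivity and the gap
   expressed through energies by [energy_midpoint]. *)
pose B x := eta + (eta * K + C * q / 2) *
    (energy p q (g x) (h x) + energy p q (g x) (k x)) +
  2 * eta * K * `|g x| `^ p - C * q * energy p q (g x) ((h x + k x) / 2).
have ihk1 : mu.-integrable setT
    (EFin \o (fun x => energy p q (g x) (h x) + energy p q (g x) (k x))).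
  exact: integrable_funD.
have i1 : mu.-integrable setT (EFin \o (fun x => eta + (eta * K + C * q / 2) *
    (energy p q (g x) (h x) + energy p q (g x) (k x)))).
  by apply: integrable_funD; [exact: integrable_fun_cst|exact: integrable_funZ].
have i2 : mu.-integrable setT (EFin \o (fun x => eta + (eta * K + C * q / 2) *
    (energy p q (g x) (h x) + energy p q (g x) (k x)) + 2 * eta * K * `|g x| `^ p)).
  by apply: integrable_funD => //; exact: integrable_funZ.
have i3 : mu.-integrable setT (EFin \o B).
  by apply: integrable_funB => //; exact: integrable_funZ.
have leB x : `|h x - k x| <= B x.
  apply: (le_trans (hC _ _)).
  have gapE : C * midpoint_gap q (h x) (k x) =
      C * q / 2 * (energy p q (g x) (h x) + energy p q (g x) (k x)) -
      C * q * energy p q (g x) ((h x + k x) / 2).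
    by rewrite energy_midpoint//; field; rewrite gt_eqF.
  rewrite gapE /B.
  have := ler_wpM2l (ltW eta0) (lerD (hK (g x) (h x)) (hK (g x) (k x))).
  by lra.
have mhk : measurable_fun setT (fun x => h x - k x).
  by apply: measurable_funB; [exact: Lfun_measurable hq|exact: Lfun_measurable kq].
apply: (@le_trans _ _ (\int[mu]_x B x)).
  apply: le_Rintegral => //.
  apply: (@le_integrable_fun _ _ _ _ _ B) => // [|x]; last by rewrite normr_id.
  exact: measurableT_comp.
rewrite /B RintegralB//; last exact: integrable_funZ.
rewrite RintegralD//; last exact: integrable_funZ.
rewrite RintegralD//; [|exact: integrable_fun_cst|exact: integrable_funZ].
rewrite !RintegralZl// RintegralD// Rintegral_cst//.
have mu1 := @probability_setT _ _ _ mu; rewrite [X in fine X]mu1 /= mulr1 -/G.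
move: (\int[mu]_x energy _ _ _ (h x)) (\int[mu]_x energy _ _ _ (k x)) hm km
  (\int[mu]_x energy _ _ _ _) mid => Ih Ik hm km Im mid.
have etaM : eta * M = e / 2 by rewrite etaE divfK// gt_eqF.
have b1 : eta * K * (Ih + Ik) <= eta * K * (2 * m + 2).
  by rewrite ler_wpM2l ?mulr_ge0 ?(ltW eta0)//; lra.
have b2 : C * q * ((Ih + Ik) / 2 - Im) <= C * q * delta.
  by rewrite ler_wpM2l//; lra.
move: etaM; rewrite /M => etaM.
have -> : eta + (eta * K + C * q / 2) * (Ih + Ik) + 2 * eta * K * G - C * q * Im
  = eta + eta * K * (Ih + Ik) + 2 * eta * K * G + C * q * ((Ih + Ik) / 2 - Im).
  by field.
have -> : e = eta * (1 + K * (2 * m + 2 + 2 * G)) + e / 2 by rewrite etaM -splitr.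
have -> : eta * (1 + K * (2 * m + 2 + 2 * G)) =
  eta + eta * K * (2 * m + 2) + 2 * eta * K * G by ring.
by lra.
Qed.

(** No differentiation under the integral is needed: the tangent inequality at h + s v bounds the
    nonnegative energy increment by s times the integral of [D s]. For s > 0 that integral is thus
    nonnegative, and dominated convergence along s = 1 / (n + 1) reaches s = 0. *)
Let energy_variation_ge0 g h (v : T -> R) :
  g \in Lfun mu p%:E -> h \in Lfun mu q%:E ->
  measurable_fun setT v -> (forall x, `|v x| <= 1) ->
  (forall s, \int[mu]_x energy p q (g x) (h x) <=
             \int[mu]_x energy p q (g x) (h x + s * v x)) ->
  0 <= \int[mu]_x ((signed_power (q - 1) (h x) - g x) * v x).
Proof.
move=> gp hq mv v1 hmin.
have vq : v \in Lfun mu q%:E by apply: Lfun_norm_le1 => //; exact: ltW.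
have hsq s : (fun x => h x + s * v x) \in Lfun mu q%:E.
  by apply: LfunD => //; [exact: ltW|apply: LfunZ => //; exact: ltW].
pose D s x := (signed_power (q - 1) (h x + s * v x) - g x) * v x.
have Fgp s : (fun x => signed_power (q - 1) (h x + s * v x) - g x) \in Lfun mu p%:E.
  by apply: LfunB => //; [exact: ltW|exact: Lfun_signed_power].
have iD s : mu.-integrable setT (EFin \o D s) by exact: Lfun_mul_integrable.
have D0 s : 0 < s -> 0 <= \int[mu]_x D s x.
  move=> s0; rewrite -(pmulr_rge0 _ s0) -RintegralZl//.
  have := hmin s; rewrite -subr_ge0 -RintegralB//; last 2 first.
  - exact: energy_integrable.
  - exact: energy_integrable.
  move/le_trans; apply; apply: le_Rintegral => //.
  - by apply: integrable_funB; exact: energy_integrable.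
  - exact: integrable_funZ.
  move=> x _; rewrite /energy /D.
  have := tangent_gap_ge0 p1 q1 pq (h x + s * v x) (h x).
  by rewrite /tangent_gap; lra.
have nh1 : (fun x => `|h x| + 1) \in Lfun mu q%:E.
  apply: LfunD; [exact: ltW| |exact: Lfun_cst].
  have mh := Lfun_measurable hq.
  apply: integrable_powR_Lfun; [exact: ltW|exact: measurableT_comp|].
  under [X in _ \o X]funext do rewrite normr_id.
  exact: Lfun_powR_integrable (ltW q1) hq.
(* A majorant of [D s] for |s| <= 1: since |h| + 1 >= 1, one has |h + s v|^(q - 1) <= (|h| + 1)^(q -
   1) <= (|h| + 1)^q. *)
pose b x := `|(`|h x| + 1)| `^ q + `|g x|.
have ib : mu.-integrable setT (EFin \o b).
  apply: integrable_funD; first exact: Lfun_powR_integrable (ltW q1) nh1.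
  exact: integrable_norm (Lfun_integrable1 (ltW p1) gp).
have Db s x : `|s| <= 1 -> `|D s x| <= b x.
  move=> s1; rewrite /D normrM.
  apply: (@le_trans _ _ `|signed_power (q - 1) (h x + s * v x) - g x|).
    by rewrite ler_piMr.
  apply: (le_trans (ler_normB _ _)); rewrite lerD2r normr_signed_power ?gt_eqF//.
  rewrite (ger0_norm (_ : 0 <= `|h x| + 1)) ?addr_ge0//.
  apply: (@le_trans _ _ ((`|h x| + 1) `^ (q - 1))).
    apply: ge0_ler_powR; rewrite ?nnegrE ?(ltW qB1)//.
    apply: (le_trans (ler_normD _ _)); rewrite lerD2l normrM.
    by rewrite mulr_ile1.
  by rewrite ler_powR ?lerBlDr ?lerDl ?lerDr.
have DE x : (signed_power (q - 1) (h x) - g x) * v x = D 0 x.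
  by rewrite /D mul0r addr0.
under eq_Rintegral do rewrite DE.
have Dcv : {ae mu, forall x, setT x ->
    (EFin \o D (harmonic n)) x @[n --> \oo] --> (EFin \o D 0) x}.
  apply: nearW => x _; apply: cvg_EFin; first exact: nearW.
  rewrite /comp/= /D; apply: cvgMl; apply: cvgB; last exact: cvg_cst.
  have cvh : h x + harmonic n * v x @[n --> \oo] --> h x + 0 * v x.
    by apply: cvgD; [exact: cvg_cst|apply: cvgMl; exact: cvg_harmonic].
  apply: (cvg_comp (fun n => h x + harmonic n * v x) (@signed_power R (q - 1)) cvh).
  exact: continuous_signed_power.
have Dn : {ae mu, forall x n, setT x ->
    (`|(EFin \o D (harmonic n)) x| <= (EFin \o b) x)%E}.
  apply: nearW => x n _; rewrite lee_fin Db//= ger0_norm ?invr_ge0//.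
  by rewrite invf_le1// ler1n.
have [_ _ cvD] := dominated_convergence measurableT
  (fun n => measurable_int _ (iD (harmonic n))) (measurable_int _ (iD 0)) Dcv ib Dn.
rewrite -lee_fin -Rintegral_EFin//; apply: (cvge_ge _ cvD).
apply: nearW => n /=; rewrite (Rintegral_EFin (iD _)).
by rewrite lee_fin D0// invr_gt0.
Qed.

(** The one-sided inequality holds for v and for -v. *)
Lemma energy_first_order g h (v : T -> R) :
  g \in Lfun mu p%:E -> h \in Lfun mu q%:E ->
  measurable_fun setT v -> (forall x, `|v x| <= 1) ->
  (forall s, \int[mu]_x energy p q (g x) (h x) <=
             \int[mu]_x energy p q (g x) (h x + s * v x)) ->
  \int[mu]_x ((signed_power (q - 1) (h x) - g x) * v x) = 0.
Proof.
move=> gp hq mv v1 hmin; apply/eqP; rewrite eq_le andbC.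
rewrite energy_variation_ge0//=.
have : 0 <= \int[mu]_x ((signed_power (q - 1) (h x) - g x) * - v x).
  apply: energy_variation_ge0 => // [|x|s]; first exact: measurableT_comp.
    by rewrite normrN.
  rewrite (_ : \int[mu]_x energy p q (g x) (h x + s * - v x) =
    \int[mu]_x energy p q (g x) (h x + - s * v x))//.
  by apply: eq_Rintegral => x _; rewrite mulrN mulNr.
rewrite (_ : \int[mu]_x ((signed_power (q - 1) (h x) - g x) * - v x) =
  \int[mu]_x (-1 * ((signed_power (q - 1) (h x) - g x) * v x))); last first.
  by apply: eq_Rintegral => x _; rewrite mulrN mulN1r.
rewrite RintegralZl// ?mulN1r ?oppr_ge0//.
apply: (@le_integrable_fun _ _ _ _ _ (fun x => `|signed_power (q - 1) (h x) - g x|)).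
- apply: measurable_funM => //; apply: measurable_funB.
    exact: Lfun_measurable (Lfun_signed_power hq).
  exact: Lfun_measurable gp.
- apply: (@integrable_norm _ _ _ mu setT); apply: (Lfun_integrable1 (ltW p1)).
  by apply: LfunB => //; [exact: ltW|exact: Lfun_signed_power].
- by move=> x; rewrite normrM ler_piMr.
Qed.

End Lp_duality.

(** Otherwise the whole space, of mass 1, would be a null set. *)
Lemma ae_exists d (T : measurableType d) (R : realType) (P : probability T R)
    (Q : T -> Prop) : {ae P, forall x, Q x} -> exists x, Q x.
Proof.
move=> [N [mN N0 QN]]; apply: contrapT => /forallNP nQ.
have NT : N = setT by apply/seteqP; split=> // x _; apply: QN => /=; exact: nQ.
by have := @probability_setT _ _ _ P; rewrite -NT N0 => -[] /eqP; rewrite eq_sym oner_eq0.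
Qed.

Lemma ae_imply d (T : measurableType d) (R : realType) (P : probability T R)
    (Q Q' : T -> Prop) : (forall x, Q x -> Q' x) ->
  {ae P, forall x, Q x} -> {ae P, forall x, Q' x}.
Proof. exact: (@filterS _ _ (ae_filter_ringOfSetsType P)). Qed.

(** * Averages of functions of one variable *)

Section average.
Context (R : realType) (P : probability (measurableTypeR R) R) (m : nat).
Implicit Types (Phi : 'I_m.+1 -> R -> R) (i : 'I_m.+1) (r : R).

Let n : R := m.+1%:R.
Let n0 : 0 < n. Proof. exact: ltr0Sn. Qed.

Lemma measurable_average Phi :
  (forall i, measurable_fun (setT : set (measurableTypeR R)) (Phi i)) ->
  measurable_fun setT (average Phi : m.+1.-tuple (measurableTypeR R) -> R).
Proof.
move=> mPhi; apply: measurable_funM; first exact: measurable_cst.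
apply: measurable_sum => i; apply: measurableT_comp (mPhi i) _.
exact: measurable_tnth.
Qed.

Lemma Lfun_tnth r k (i : 'I_k) (f : R -> R) : 1 <= r -> f \in Lfun P r%:E ->
  (fun x => f (tnth x i)) \in Lfun (tuple_power P k) r%:E.
Proof.
move=> r1 fr; apply: integrable_powR_Lfun => //.
  exact: (measurableT_comp (Lfun_measurable fr) (measurable_tnth i)).
exact: (integrable_tnth i (Lfun_powR_integrable r1 fr)).
Qed.

Lemma Lfun_average r Phi : 1 <= r -> (forall i, Phi i \in Lfun P r%:E) ->
  average Phi \in Lfun (tuple_power P m.+1) r%:E.
Proof.
move=> r1 Phir; apply: LfunZ => //; apply: Lfun_sum => // i.
exact: Lfun_tnth.
Qed.

Lemma average_insert Phi i t (y : m.-tuple R) :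
  average Phi (insert_coord i t (y : m.+1.-1.-tuple R)) =
  n^-1 * (Phi i t + \sum_(k < m) Phi (lift i k) (tnth y k)).
Proof.
rewrite /average (bigD1_ord i)//= tnth_insert_coord.
by under eq_bigr do rewrite tnth_insert_coord_lift.
Qed.

(** For almost every choice y of the other coordinates the section of |average|^r is integrable; one
    such y suffices, since along it the average is Phi_i / n plus a constant. *)
Lemma Lfun_average_inv r Phi : 1 <= r ->
  (forall i, measurable_fun (setT : set (measurableTypeR R)) (Phi i)) ->
  average Phi \in Lfun (tuple_power P m.+1) r%:E ->
  forall i, Phi i \in Lfun P r%:E.
Proof.
move=> r1 mPhi avr i.
have := integrable_insert_coord i (Lfun_powR_integrable r1 avr).
move=> /ae_integrable2 /ae_exists[y iy].
pose c := \sum_(k < m) Phi (lift i k) (tnth y k).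
have nr : (fun t => n^-1 * (Phi i t + c)) \in Lfun P r%:E.
  apply: integrable_powR_Lfun => //.
    apply: measurable_funM; first exact: measurable_cst.
    by apply: measurable_funD => //; exact: measurable_cst.
  by under [X in _ \o X]funext do rewrite -average_insert.
have := LfunB r1 (LfunZ n r1 nr) (Lfun_cst P c r).
under [X in X \in _ -> _]funext do
  rewrite mulrA mulfV ?gt_eqF// mul1r addrK.
by [].
Qed.

Definition normalized Phi :=
  forall i, (0 < i)%N -> \int[P]_t Phi i t = 0.

(** Every component gives up its mean and component 0 receives the sum of all means, so the added
    constants sum to zero. *)
Lemma normalize Phi : (forall i, P.-integrable setT (EFin \o Phi i)) ->
  exists c : 'I_m.+1 -> R, normalized (fun i t => Phi i t + c i) /\
    average (fun i t => Phi i t + c i) =1 average Phi.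
Proof.
move=> iPhi; pose a i := \int[P]_t Phi i t.
exists (fun i => (if i == ord0 then \sum_j a j else 0) - a i); split.
- move=> i i0; rewrite RintegralD//; last exact: integrable_fun_cst.
  have P1 := @probability_setT _ _ _ P.
  rewrite Rintegral_cst// [X in fine X]P1 /= mulr1 -/(a i).
  by rewrite ifF ?add0r ?subrr//; apply/eqP => i0'; rewrite i0' in i0.
- move=> x; rewrite /average big_split/= sumrB -big_mkcond/= big_pred1_eq.
  by rewrite subrr addr0.
Qed.

Let integrable_average_insert Phi i t :
  (forall i, P.-integrable setT (EFin \o Phi i)) ->
  (tuple_power P m).-integrable setT
    (EFin \o (fun y : m.-tuple R =>
      average Phi (insert_coord i t (y : m.+1.-1.-tuple R)))).
Proof.
move=> iPhi; under [X in _ \o X]funext do rewrite average_insert.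
apply: integrable_funZ; apply: integrable_funD; first exact: integrable_fun_cst.
apply: integrable_fun_sum => k.
exact: (integrable_tnth k (iPhi (lift i k))).
Qed.

Lemma Rintegral_average_insert Phi i t :
  (forall i, P.-integrable setT (EFin \o Phi i)) ->
  \int[tuple_power P m]_y average Phi (insert_coord i t (y : m.+1.-1.-tuple R)) =
  n^-1 * (Phi i t + \sum_(k < m) \int[P]_u Phi (lift i k) u).
Proof.
move=> iPhi.
have ik k : (tuple_power P m).-integrable setT
    (EFin \o (fun y => Phi (lift i k) (tnth y k))).
  exact: (integrable_tnth k (iPhi (lift i k))).
have isum s : (tuple_power P m).-integrable setT
    (EFin \o (fun y => \sum_(k <- s) Phi (lift i k) (tnth y k))).
  exact: integrable_fun_sum.
under eq_Rintegral do rewrite average_insert.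
rewrite RintegralZl//; last first.
  by apply: integrable_funD; [exact: integrable_fun_cst|exact: isum].
rewrite RintegralD//; last exact: integrable_fun_cst.
have P1 := @probability_setT _ _ _ (tuple_power P m).
rewrite Rintegral_cst// [X in fine X]P1 /= mulr1; congr (_ * (_ + _)).
elim: (index_enum _) => [|k s IHs].
  rewrite big_nil; under eq_Rintegral do rewrite big_nil.
  by rewrite Rintegral_cst// mul0r.
rewrite big_cons; under eq_Rintegral do rewrite big_cons.
rewrite RintegralD// IHs; congr (fine _ + _).
exact: (integral_tnth P k (measurable_int _ (iPhi (lift i k)))).
Qed.

(** Integrating out the other coordinates turns the average into 1 / n times the shifted component,
    the shift being the sum of the other means; this operation does not increase the L^1 norm. *)
Let shifted_L1_le Phi i : (forall i, P.-integrable setT (EFin \o Phi i)) ->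
  \int[P]_t `|Phi i t + \sum_(k < m) \int[P]_u Phi (lift i k) u| <=
  n * \int[tuple_power P m.+1]_x `|average Phi x|.
Proof.
move=> iPhi; set c := \sum_(k < m) _.
have iPc : P.-integrable setT (EFin \o (fun t => Phi i t + c)).
  by apply: integrable_funD; [exact: iPhi|exact: integrable_fun_cst].
have iav : (tuple_power P m.+1).-integrable setT (EFin \o average Phi).
  apply: integrable_funZ; apply: integrable_fun_sum => j.
  exact: (integrable_tnth j (iPhi j)).
have inav := integrable_norm iav.
have inPc := integrable_norm iPc.
rewrite -ler_pdivrMl// -RintegralZl// -lee_fin -!Rintegral_EFin//; last first.
  exact: integrable_funZ.
rewrite [leRHS](ge0_integral_tuple_power _ i)//; last first.
  exact: measurable_int inav.
apply: ge0_le_integral => //.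
- by move=> t _; rewrite lee_fin mulr_ge0// invr_ge0 ltW.
- exact: measurable_int (integrable_funZ _ inPc).
- apply: (@measurable_fun_fubini_tonelli_F _ _ _ _ _ (tuple_power P m)
    (fun z => `|average Phi (insert_coord i z.1 (z.2 : m.+1.-1.-tuple R))|%:E)).
    exact: measurable_int (integrable_insert_coord i inav).
  by move=> z; rewrite lee_fin.
move=> t _.
have iat := integrable_average_insert i t iPhi.
rewrite -[n^-1]ger0_norm ?invr_ge0 ?(ltW n0)// -normrM.
rewrite -Rintegral_average_insert// EFin_normr_Rintegral//.
exact: (le_abse_integral _ measurableT (measurable_int _ iat)).
Qed.

(** For component 0 the shift vanishes by normalization. For any other component the shift is the
    mean of component 0, already bounded by the first case; hence the factor 2. *)
Lemma normalized_L1_le Phi : (forall i, P.-integrable setT (EFin \o Phi i)) ->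
  normalized Phi -> forall i, \int[P]_t `|Phi i t| <=
  2 * n * \int[tuple_power P m.+1]_x `|average Phi x|.
Proof.
move=> iPhi nPhi i; set I := \int[tuple_power P m.+1]_x _.
have I0 : 0 <= n * I by rewrite mulr_ge0 ?(ltW n0)//; apply: Rintegral_ge0.
have h0 : \int[P]_t `|Phi ord0 t| <= n * I.
  have := shifted_L1_le ord0 iPhi.
  rewrite big1 => [|k _]; last exact: nPhi.
  by under eq_Rintegral do rewrite addr0.
case: (unliftP ord0 i) => [k|] ->; last first.
  by rewrite (le_trans h0)// -mulrA ler_peMl// ler1n.
have m0 : (0 < m)%N by case: (m) k => [[]|].
have := shifted_L1_le (lift ord0 k) iPhi.
set c := \sum_(k < m) _ => hc.
have cI : `|c| <= n * I.
  (* Among the indices other than that of the chosen component, z is the one that designates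
     component 0. *)
  pose z : 'I_m := Ordinal m0.
  rewrite /c (bigD1 z)//= big1 ?addr0; last first.
    move=> l lz; apply: nPhi.
    by rewrite /= addn_gt0 [X in _ || X]lt0n -[X in _ || ~~ X]/(l == z) lz orbT.
  have -> : lift (lift ord0 k) z = ord0 by apply/val_inj.
  by apply: le_trans (le_normr_Rintegral _ _) h0.
apply: (@le_trans _ _ (\int[P]_t (`|Phi (lift ord0 k) t + c| + `|c|))).
  apply: le_Rintegral => //.
  - exact: integrable_norm (iPhi _).
  - apply: integrable_funD; last exact: integrable_fun_cst.
    apply: (@integrable_norm _ _ _ P setT).
    by apply: integrable_funD; [exact: iPhi|exact: integrable_fun_cst].
  - by move=> t _; rewrite -{1}(addrK c (Phi _ t)) (le_trans (ler_normB _ _)).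
rewrite RintegralD//; last 2 first.
- apply: (@integrable_norm _ _ _ P setT).
  by apply: integrable_funD; [exact: iPhi|exact: integrable_fun_cst].
- exact: integrable_fun_cst.
have P1 := @probability_setT _ _ _ P.
rewrite Rintegral_cst// [X in fine X]P1 /= mulr1 -mulrA mulr_natl mulr2n.
exact: lerD.
Qed.

End average.

(** * Minimizing the energy *)

Section minimizer.
Context (R : realType) (P : probability (measurableTypeR R) R) (m : nat).
Context (p q : R).
Hypotheses (p1 : 1 < p) (q1 : 1 < q) (pq : p^-1 + q^-1 = 1).
Context (g : m.+1.-tuple R -> R).
Hypothesis gp : g \in Lfun (tuple_power P m.+1) p%:E.
Implicit Types (Phi Psi : 'I_m.+1 -> R -> R) (i : 'I_m.+1).

Let q0 : 0 < q. Proof. exact: lt_trans ltr01 q1. Qed.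

Let Lq Phi := forall i, Phi i \in Lfun P q%:E.

Let J Phi := \int[tuple_power P m.+1]_x energy p q (g x) (average Phi x).

Let Lq_average Phi : Lq Phi ->
  average Phi \in Lfun (tuple_power P m.+1) q%:E.
Proof. by move=> Phiq; apply: Lfun_average => //; exact: ltW. Qed.

Let J_ge0 Phi : 0 <= J Phi.
Proof. by apply: Rintegral_ge0 => x _; exact: energy_ge0. Qed.

Let averageD Phi Psi x :
  average (fun i t => Phi i t + Psi i t) x = average Phi x + average Psi x.
Proof. by rewrite /average big_split/= mulrDr. Qed.

Let averageZ a Phi x : average (fun i t => a * Phi i t) x = a * average Phi x.
Proof. by rewrite /average -mulr_sumr mulrCA. Qed.

Let averageB Phi Psi x :
  average (fun i t => Phi i t - Psi i t) x = average Phi x - average Psi x.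
Proof. by rewrite /average sumrB mulrBr. Qed.

Let LqD Phi Psi : Lq Phi -> Lq Psi -> Lq (fun i t => Phi i t + Psi i t).
Proof. by move=> Phiq Psiq i; apply: LfunD => //; exact: ltW. Qed.

Let LqZ a Phi : Lq Phi -> Lq (fun i t => a * Phi i t).
Proof. by move=> Phiq i; apply: LfunZ => //; exact: ltW. Qed.

Let Lq_integrable Phi : Lq Phi -> forall i, P.-integrable setT (EFin \o Phi i).
Proof. by move=> Phiq i; exact: Lfun_integrable1 (ltW q1) (Phiq i). Qed.

Let S := [set J Phi | Phi in Lq].

Let has_inf_S : has_inf S.
Proof.
split; last by exists 0 => _ [Phi _ <-]; exact: J_ge0.
by exists (J (fun=> cst 0)), (fun=> cst 0) => // i; exact: Lfun_cst.
Qed.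

Let inf_S_le Phi : Lq Phi -> inf S <= J Phi.
Proof. by move=> Phiq; apply: ge_inf; [exact: has_inf_S.2|exists Phi]. Qed.

Let inf_S_ge0 : 0 <= inf S.
Proof.
by apply: lb_le_inf; [exact: has_inf_S.1|move=> _ [Phi _ <-]; exact: J_ge0].
Qed.

(** Normalizing leaves the average, hence the energy, unchanged. *)
Let near_inf e : 0 < e -> exists Phi, [/\ Lq Phi, normalized P Phi & J Phi <= inf S + e].
Proof.
move=> e0; have [_ [Phi Phiq <-] Phie] := inf_adherent e0 has_inf_S.
have [c [nPhi avPhi]] := normalize (Lq_integrable Phiq).
exists (fun i t => Phi i t + c i); split => //.
  move=> i; apply: LfunD => //; [exact: ltW|exact: Lfun_cst].
rewrite (le_trans _ (ltW Phie))// /J.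
by under eq_Rintegral do rewrite avPhi.
Qed.

(** The midpoint of two admissible families is admissible, so its energy is at least the infimum and
    [energy_L1_dist] bounds the averages; the difference is normalized, so its components are
    bounded too. *)
Let near_inf_L1 e : 0 < e -> exists2 delta, 0 < delta & forall Phi Psi,
  Lq Phi -> Lq Psi -> normalized P Phi -> normalized P Psi ->
  J Phi <= inf S + delta -> J Psi <= inf S + delta ->
  forall i, \int[P]_t `|Phi i t - Psi i t| <= 2 * m.+1%:R * e.
Proof.
move=> e0.
have [delta d0 hd] := energy_L1_dist p1 q1 pq gp inf_S_ge0 e0.
exists delta => // Phi Psi Phiq Psiq nPhi nPsi JPhi JPsi i.
have iPhi := Lq_integrable Phiq; have iPsi := Lq_integrable Psiq.
apply: (le_trans (@normalized_L1_le _ P m (fun i t => Phi i t - Psi i t) _ _ i)).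
- by move=> j; exact: integrable_funB.
- by move=> j j0; rewrite RintegralB// nPhi// nPsi// subrr.
rewrite ler_wpM2l ?mulr_ge0//.
under eq_Rintegral do rewrite averageB.
apply: hd => //; [exact: Lq_average|exact: Lq_average|].
have := inf_S_le (LqZ 2^-1 (LqD Phiq Psiq)).
rewrite /J; under eq_Rintegral do rewrite averageZ averageD mulrC.
by [].
Qed.

Let minimizing_sequence : exists Phi : nat -> 'I_m.+1 -> R -> R,
  [/\ forall k, Lq (Phi k), forall k, J (Phi k) <= inf S + harmonic k &
    forall k i, \int[P]_t `|Phi k.+1 i t - Phi k i t| <=
      2 * m.+1%:R / (2 ^ k.+1)%:R].
Proof.
have e0 k : 0 < (2 ^ k.+1)%:R^-1 :> R by rewrite invr_gt0 ltr0n expn_gt0.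
have [delta hdelta] := choice (fun k => 
  let: ex_intro2 d d0 hd := near_inf_L1 (e0 k) in ex_intro _ d (conj d0 hd)).
(* Including [delta k.-1] makes the family of index k + 1 lie within [delta k] of the infimum as
   well, so that consecutive families can be compared. *)
pose thr k := Num.min (Num.min (delta k) (delta k.-1)) (harmonic k).
have thr0 k : 0 < thr k.
  rewrite !lt_min (hdelta k).1 (hdelta k.-1).1/=.
  by rewrite invr_gt0.
have [Phi hPhi] := choice (fun k => near_inf (thr0 k)).
exists Phi; split => [k|k|k i].
- by have [] := hPhi k.
- have [_ _ /le_trans] := hPhi k; apply.
  by rewrite lerD2l /thr ge_min lexx orbT.
- have [Lk nk Jk] := hPhi k; have [Lk1 nk1 Jk1] := hPhi k.+1.
  apply: (hdelta k).2 => //.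
    by rewrite (le_trans Jk1)// lerD2l /thr !ge_min lexx orbT.
  by rewrite (le_trans Jk)// lerD2l /thr !ge_min lexx.
Qed.

(** The direct method, with lower semicontinuity supplied by almost everywhere convergence and
    Fatou's lemma. *)
Lemma exists_minimizer : exists2 Phi, (forall i, Phi i \in Lfun P q%:E) &
  forall Psi, (forall i, Psi i \in Lfun P q%:E) ->
  \int[tuple_power P m.+1]_x energy p q (g x) (average Phi x) <=
  \int[tuple_power P m.+1]_x energy p q (g x) (average Psi x).
Proof.
have [Phi [Phiq PhiJ Phi1]] := minimizing_sequence.
have mPhi k i := Lfun_measurable (Phiq k i).
have C0 : 0 <= 2 * m.+1%:R :> R by rewrite mulr_ge0.
have fast i k : (\int[P]_t `|Phi k.+1 i t - Phi k i t|%:E <=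
    (2 * m.+1%:R / (2 ^ k.+1)%:R)%:E)%E.
  rewrite Rintegral_EFin ?lee_fin//.
  apply: (@integrable_norm _ _ _ P setT); apply: integrable_funB;
  exact: Lq_integrable.
have [Psi Psi_lim] := choice (fun i =>
  let: ex_intro2 f mf cf := ae_cvgn_fast C0 (mPhi ^~ i) (fast i) in
  ex_intro _ f (conj mf cf)).
have mPsi i := (Psi_lim i).1.
have cvPsi : {ae tuple_power P m.+1, forall x,
    average (Phi k) x @[k --> \oo] --> average Psi x}.
  have : {ae tuple_power P m.+1, forall x i,
      Phi k i (tnth x i) @[k --> \oo] --> Psi i (tnth x i)}.
    apply: (@filter_forall _ _ _ _ (ae_filter_ringOfSetsType (tuple_power P m.+1))) => i.
    exact: (ae_tnth i (Psi_lim i).2).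
  apply: ae_imply => x cvx.
  apply: cvgMr; rewrite /average.
  by apply: cvg_big; [exact: add_continuous|move=> i _; exact: cvx].
have EJ k : (\int[tuple_power P m.+1]_x (energy p q (g x) (average (Phi k) x))%:E =
    (J (Phi k))%:E)%E.
  by rewrite Rintegral_EFin//; exact: energy_integrable (Lq_average (Phiq k)).
have mg := Lfun_measurable gp.
have mE k : measurable_fun (setT : set (m.+1.-tuple (measurableTypeR R)))
    (fun x => energy p q (g x) (average (Phi k) x)).
  apply: measurable_energy => //.
  by apply: measurable_average; exact: mPhi.
have mEPsi : measurable_fun setT (fun x => (energy p q (g x) (average Psi x))%:E).
  by apply/measurable_EFinP/measurable_energy => //; exact: measurable_average.
have E0 (x y : R) : (0 <= (energy p q x y)%:E)%E.
  by rewrite lee_fin; exact: energy_ge0.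
have cE (x : R) : continuous (energy p q x).
  move=> y; apply: cvgB; last by apply: cvgMr; exact: cvg_id.
  apply: cvgD; first exact: cvg_cst.
  by apply: cvgMl; exact: continuous_norm_powR.
(* Almost everywhere the energy density of the limit is the lower limit of the densities; Fatou's
   lemma compares its integral with the limit of [J (Phi k)], squeezed to the infimum. *)
have ePsi : (\int[tuple_power P m.+1]_x (energy p q (g x) (average Psi x))%:E <=
    (inf S)%:E)%E.
  have -> : (\int[tuple_power P m.+1]_x (energy p q (g x) (average Psi x))%:E =
    \int[tuple_power P m.+1]_x
      limn_einf (fun k => (energy p q (g x) (average (Phi k) x))%:E))%E.
    apply: ae_eq_integral => //.
      apply: measurableT_comp => //; apply: measurable_fun_limn_esup => k.
      by apply/measurable_EFinP/measurable_funN; exact: mE.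
    apply: ae_imply cvPsi => x cvx _.
    apply/esym/(fun cv => (cvg_limn_einf_sup cv).1).
    apply: cvg_EFin; first exact: nearW.
    exact: (cvg_comp (fun k => average (Phi k) x) (energy p q (g x)) cvx (cE _ _)).
  apply: (le_trans (fatou _ _ _ _)) => //.
    by move=> k; apply/measurable_EFinP; exact: mE.
  under [X in limn_einf X]eq_fun do rewrite EJ.
  suff cvJ : (J (Phi k))%:E @[k --> \oo] --> (inf S)%:E.
    by rewrite (cvg_limn_einf_sup cvJ).1.
  apply: cvg_EFin; first exact: nearW.
  apply: (@squeeze_cvgr _ _ _ _ (cst (inf S)) (fun k => inf S + harmonic k)).
  - by apply: nearW => k; rewrite inf_S_le// PhiJ.
  - exact: cvg_cst.
  - rewrite -[X in _ --> X]addr0.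
    by apply: cvgD; [exact: cvg_cst|exact: cvg_harmonic].
have iPsi : (tuple_power P m.+1).-integrable setT
    (EFin \o (fun x => energy p q (g x) (average Psi x))).
  apply/integrableP; split => //.
  under eq_integral do rewrite (gee0_abs (E0 _ _)).
  exact: le_lt_trans ePsi (ltry _).
(* So far the limits are only measurable. Finite energy puts their average in L^q, and
   [Lfun_average_inv] then does so for each of them. *)
have avq : average Psi \in Lfun (tuple_power P m.+1) q%:E.
  by apply: energy_integrable_Lfun iPsi => //; exact: measurable_average.
exists Psi => [i|Psi' Psi'q].
  by apply: Lfun_average_inv avq i => //; exact: ltW.
apply: (@le_trans _ _ (inf S)); last exact: inf_S_le.
by rewrite -lee_fin -Rintegral_EFin.
Qed.

End minimizer.

(** * The marginal equations *)

Section marginal_equations.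
Context (R : realType) (P : probability (measurableTypeR R) R) (m : nat).
Implicit Types (F G : m.+1.-tuple R -> R) (i : 'I_m.+1) (f : R -> R).

Local Notation marg F i t :=
  (\int[tuple_power P m]_y (F (insert_coord i t (y : m.+1.-1.-tuple R)))%:E)%E.

(** After Fubini the factor f(t) is constant in the inner integral; it can be pulled out for almost
    every t, namely where the section of F is integrable. *)
Lemma integral_mul_tnth F i f :
  (tuple_power P m.+1).-integrable setT (EFin \o F) ->
  (tuple_power P m.+1).-integrable setT (EFin \o (fun x => F x * f (tnth x i))) ->
  measurable_fun (setT : set (measurableTypeR R)) f ->
  (\int[tuple_power P m.+1]_x (F x * f (tnth x i))%:E =
   \int[P]_t ((f t)%:E * marg F i t))%E.
Proof.
move=> iF iFf mf; rewrite (integral_tuple_power i iFf).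
have iFi := integrable_insert_coord i iF.
have iFfi := integrable_insert_coord i iFf.
apply: ae_eq_integral => //.
- exact: (measurable_int _ (integrable_fubini_F iFfi)).
- apply: emeasurable_funM; first exact/measurable_EFinP.
  exact: (measurable_int _ (integrable_fubini_F iFi)).
apply: ae_imply (ae_integrable1 iFi) => t it _.
under eq_integral do rewrite /= tnth_insert_coord mulrC EFinM.
by rewrite integralZl.
Qed.

Lemma eq_integral_mul_tnth F G i f :
  (tuple_power P m.+1).-integrable setT (EFin \o F) ->
  (tuple_power P m.+1).-integrable setT (EFin \o G) ->
  (tuple_power P m.+1).-integrable setT (EFin \o (fun x => F x * f (tnth x i))) ->
  (tuple_power P m.+1).-integrable setT (EFin \o (fun x => G x * f (tnth x i))) ->
  measurable_fun (setT : set (measurableTypeR R)) f ->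
  {ae P, forall t, marg F i t = marg G i t} ->
  (\int[tuple_power P m.+1]_x (F x * f (tnth x i))%:E =
   \int[tuple_power P m.+1]_x (G x * f (tnth x i))%:E)%E.
Proof.
move=> iF iG iFf iGf mf FG.
rewrite (integral_mul_tnth iF iFf mf) (integral_mul_tnth iG iGf mf).
apply: ae_eq_integral => //.
- apply: emeasurable_funM; first exact/measurable_EFinP.
  exact: (measurable_int _ (integrable_fubini_F (integrable_insert_coord i iF))).
- apply: emeasurable_funM; first exact/measurable_EFinP.
  exact: (measurable_int _ (integrable_fubini_F (integrable_insert_coord i iG))).
by apply: ae_imply FG => t -> _.
Qed.

(** Testing against indicators of the i-th coordinate says that the marginals have equal integrals
    over every measurable set. *)
Lemma ae_eq_marginal F G i :
  (tuple_power P m.+1).-integrable setT (EFin \o F) ->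
  (tuple_power P m.+1).-integrable setT (EFin \o G) ->
  (forall A : set (measurableTypeR R), measurable A ->
    (\int[tuple_power P m.+1]_x (F x * \1_A (tnth x i))%:E =
     \int[tuple_power P m.+1]_x (G x * \1_A (tnth x i))%:E)%E) ->
  {ae P, forall t, marg F i t = marg G i t}.
Proof.
move=> iF iG FG.
have imF := integrable_fubini_F (integrable_insert_coord i iF).
have imG := integrable_fubini_F (integrable_insert_coord i iG).
have indic H (A : set (measurableTypeR R)) : measurable A ->
  (tuple_power P m.+1).-integrable setT (EFin \o H) ->
  (tuple_power P m.+1).-integrable setT (EFin \o (fun x => H x * \1_A (tnth x i))).
  move=> mA iH; apply: (@le_integrable_fun _ _ _ _ _ (fun x => `|H x|)).
  - apply: measurable_funM; first by apply/measurable_EFinP; exact: measurable_int iH.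
    exact: (measurableT_comp (measurable_indic mA) (measurable_tnth i)).
  - exact: integrable_norm iH.
  - move=> x; rewrite normrM ler_piMr// indicE normr_nat.
    by case: (_ \in _).
have := @integral_ae_eq _ _ _ P setT measurableT _ _ imF (measurable_int _ imG).
move=> H; apply: ae_imply (H _) => [t /(_ I)//|A _ mA].
have mf : measurable_fun (setT : set (measurableTypeR R)) (\1_A : R -> R).
  exact: measurable_indic.
have := FG A mA.
rewrite (integral_mul_tnth iF (indic _ _ mA iF) mf).
rewrite (integral_mul_tnth iG (indic _ _ mA iG) mf).
rewrite [in X in _ -> X]integral_mkcond [in X in _ -> _ = X]integral_mkcond.
have restr (h : R -> \bar R) : h \_ A = (fun t => (\1_A t)%:E * h t)%E.
  apply/funext => t; rewrite patchE indicE.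
  by case: (t \in A); rewrite ?mul1e ?mul0e.
by rewrite !restr.
Qed.

End marginal_equations.

(** * Existence, uniqueness and energy of solutions *)

Section solution.
Context (R : realType) (P : probability (measurableTypeR R) R) (m : nat).
Context (p q : R).
Hypotheses (p1 : 1 < p) (q1 : 1 < q) (pq : p^-1 + q^-1 = 1).
Implicit Types (F G : m.+1.-tuple R -> R) (i : 'I_m.+1).
Implicit Types Phi Psi : 'I_m.+1 -> R -> R.

Let p0 : 0 < p. Proof. exact: lt_trans ltr01 p1. Qed.

Local Notation marg F i t :=
  (\int[tuple_power P m]_y (F (insert_coord i t (y : m.+1.-1.-tuple R)))%:E)%E.
Local Notation dual Phi := (fun x => signed_power (q - 1) (average Phi x)).

Let Lq_average Phi : (forall i, Phi i \in Lfun P q%:E) ->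
  average Phi \in Lfun (tuple_power P m.+1) q%:E.
Proof. by move=> Phiq; apply: Lfun_average => //; exact: ltW. Qed.

Let Lp_dual Phi : (forall i, Phi i \in Lfun P q%:E) ->
  dual Phi \in Lfun (tuple_power P m.+1) p%:E.
Proof. by move=> Phiq; apply: Lfun_signed_power => //; exact: Lq_average. Qed.

Let averageB Phi Psi x :
  average (fun i t => Phi i t - Psi i t) x = average Phi x - average Psi x.
Proof. by rewrite /average sumrB mulrBr. Qed.

(** An average is a linear combination of functions of one coordinate, and pairing with such a
    function involves only the corresponding marginal. *)
Lemma eq_Rintegral_mul_average F G Phi :
  F \in Lfun (tuple_power P m.+1) p%:E -> G \in Lfun (tuple_power P m.+1) p%:E ->
  (forall i, Phi i \in Lfun P q%:E) ->
  (forall i, {ae P, forall t, marg F i t = marg G i t}) ->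
  \int[tuple_power P m.+1]_x (F x * average Phi x) =
  \int[tuple_power P m.+1]_x (G x * average Phi x).
Proof.
move=> Fp Gp Phiq FG.
have iPhi H i : H \in Lfun (tuple_power P m.+1) p%:E ->
    (tuple_power P m.+1).-integrable setT
      (EFin \o (fun x => H x * Phi i (tnth x i))).
  move=> Hp; apply: (Lfun_mul_integrable p1 q1 pq Hp).
  by apply: Lfun_tnth => //; exact: ltW.
have split H : H \in Lfun (tuple_power P m.+1) p%:E ->
    \int[tuple_power P m.+1]_x (H x * average Phi x) =
    m.+1%:R^-1 * \sum_i \int[tuple_power P m.+1]_x (H x * Phi i (tnth x i)).
  move=> Hp; under eq_Rintegral do rewrite mulrCA mulr_sumr.
  rewrite RintegralZl//; last by apply: integrable_fun_sum => i; exact: iPhi.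
  congr (_ * _); elim: (index_enum _) => [|i s IHs].
    rewrite big_nil; under eq_Rintegral do rewrite big_nil.
    by rewrite Rintegral_cst// mul0r.
  rewrite big_cons; under eq_Rintegral do rewrite big_cons.
  rewrite RintegralD ?IHs//; first exact: iPhi.
  by apply: integrable_fun_sum => j; exact: iPhi.
rewrite !split//; congr (_ * _); apply: eq_bigr => i _; congr fine.
apply: eq_integral_mul_tnth; [| |exact: iPhi|exact: iPhi| |exact: FG].
- exact: Lfun_integrable1 (ltW p1) Fp.
- exact: Lfun_integrable1 (ltW p1) Gp.
- exact: Lfun_measurable (Phiq i).
Qed.

(** The equations are the Euler-Lagrange equations of the minimizer, tested on indicators of one
    coordinate; normalizing afterwards keeps the average. *)
Lemma exists_solution G : G \in Lfun (tuple_power P m.+1) p%:E ->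
  exists Phi, [/\ forall i, Phi i \in Lfun P q%:E,
    forall i, {ae P, forall t, marg (dual Phi) i t = marg G i t} &
    normalized P Phi].
Proof.
move=> Gp; have [Phi Phiq Phimin] := exists_minimizer p1 q1 pq Gp.
have [c [nPhi avPhi]] := normalize (fun i => Lfun_integrable1 (ltW q1) (Phiq i)).
exists (fun i t => Phi i t + c i); split => // i.
  by apply: LfunD => //; [exact: ltW|exact: Lfun_cst].
have -> : average (fun i t => Phi i t + c i) = average Phi by exact/funext.
have Fp := Lp_dual Phiq.
apply: (@ae_eq_marginal _ P m (dual Phi) G i).
- exact: Lfun_integrable1 (ltW p1) Fp.
- exact: Lfun_integrable1 (ltW p1) Gp.
move=> A mA; pose v (x : m.+1.-tuple R) : R := \1_A (tnth x i).
have mv : measurable_fun (setT : set (m.+1.-tuple (measurableTypeR R))) v.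
  exact: (measurableT_comp (measurable_indic mA) (measurable_tnth i)).
have v1 x : `|v x| <= 1 by rewrite /v indicE normr_nat; case: (_ \in _).
have iv H : H \in Lfun (tuple_power P m.+1) p%:E ->
  (tuple_power P m.+1).-integrable setT (EFin \o (fun x => H x * v x)).
  move=> Hp; apply: (@le_integrable_fun _ _ _ _ _ (fun x => `|H x|)).
  - by apply: measurable_funM => //; exact: Lfun_measurable Hp.
  - exact: integrable_norm (Lfun_integrable1 (ltW p1) Hp).
  - by move=> x; rewrite normrM ler_piMr.
rewrite !Rintegral_EFin; [|exact: iv|exact: iv].
congr EFin; apply/eqP; rewrite -subr_eq0 -RintegralB//; [|exact: iv|exact: iv].
apply/eqP; rewrite -(energy_first_order p1 q1 pq Gp (Lq_average Phiq) mv v1).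
  by apply: eq_Rintegral => x _; rewrite mulrBl.
(* Only component i is perturbed; the factor m + 1 cancels the division in [average], which
   therefore changes by exactly s v. *)
move=> s; pose Psi j t := Phi j t + s * m.+1%:R * ((j == i)%:R * \1_A t).
rewrite (_ : \int[tuple_power P m.+1]_x energy p q (G x) (average Phi x + s * v x) =
    \int[tuple_power P m.+1]_x energy p q (G x) (average Psi x)).
  apply: Phimin => j; apply: LfunD => //; [exact: ltW|].
  do 2 (apply: LfunZ; first exact: ltW).
  apply: Lfun_norm_le1; [exact: ltW|exact: measurable_indic|].
  by move=> t; rewrite indicE normr_nat; case: (_ \in _).
apply: eq_Rintegral => x _; congr energy.
rewrite /average big_split/= mulrDr; congr (_ + _).
rewrite -mulr_sumr (bigD1 i)//= eqxx mul1r big1 ?addr0; last first.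
  by move=> j /negbTE ->; rewrite mul0r.
by rewrite [s * _%:R]mulrC -[in RHS]mulrA mulKf ?pnatr_eq0.
Qed.

(** The difference of the averages is itself an average, so its pairing with the difference of the
    duals vanishes. Strict monotonicity makes the averages equal almost everywhere, and
    [normalized_L1_le] separates the components. *)
Lemma solution_unique G Phi Psi :
  (forall i, Phi i \in Lfun P q%:E) -> (forall i, Psi i \in Lfun P q%:E) ->
  (forall i, {ae P, forall t, marg (dual Phi) i t = marg G i t}) ->
  (forall i, {ae P, forall t, marg (dual Psi) i t = marg G i t}) ->
  normalized P Phi -> normalized P Psi ->
  forall i, {ae P, forall t, Phi i t = Psi i t}.
Proof.
move=> Phiq Psiq PhiG PsiG nPhi nPsi i.
have PhiPsi j : {ae P, forall t, marg (dual Phi) j t = marg (dual Psi) j t}.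
  have := @filterI _ _ (ae_filter_ringOfSetsType P) _ _ (PhiG j) (PsiG j).
  by apply: ae_imply => t [-> ->].
pose D j t := Phi j t - Psi j t.
have Dq j : D j \in Lfun P q%:E by apply: LfunB => //; exact: ltW.
have iD j := Lfun_integrable1 (ltW q1) (Dq j).
have nD : normalized P D.
  move=> j j0; rewrite RintegralB// ?nPhi ?nPsi ?subrr//;
  exact: Lfun_integrable1 (ltW q1) _.
pose M x := (dual Phi x - dual Psi x) * (average Phi x - average Psi x).
have iM : (tuple_power P m.+1).-integrable setT (EFin \o M).
  apply: (Lfun_mul_integrable p1 q1 pq).
    by apply: LfunB; [exact: ltW|exact: Lp_dual|exact: Lp_dual].
  by apply: LfunB; [exact: ltW|exact: Lq_average|exact: Lq_average].
have M0 : (\int[tuple_power P m.+1]_x `|(M x)%:E| = 0)%E.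
  under eq_integral do rewrite /= (ger0_norm (signed_power_mono p1 q1 pq _ _)).
  rewrite Rintegral_EFin//; congr EFin.
  rewrite (_ : \int[tuple_power P m.+1]_x M x = \int[tuple_power P m.+1]_x
    (dual Phi x * average D x - dual Psi x * average D x)); last first.
    by apply: eq_Rintegral => x _; rewrite /M -mulrBl averageB.
  rewrite RintegralB//; last 2 first.
  - exact: Lfun_mul_integrable (Lp_dual Phiq) (Lq_average Dq).
  - exact: Lfun_mul_integrable (Lp_dual Psiq) (Lq_average Dq).
  by rewrite (eq_Rintegral_mul_average (Lp_dual Phiq) (Lp_dual Psiq) Dq PhiPsi) subrr.
have avD : {ae tuple_power P m.+1, forall x, average D x = 0}.
  have := (ae_eq_integral_abs _ measurableT (measurable_int _ iM)).1 M0.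
  apply: ae_imply => x /(_ I) [] /(signed_power_strict_mono p1 q1 pq) xE.
  by rewrite averageB xE subrr.
have D0 : \int[P]_t `|D i t| <= 0.
  rewrite (le_trans (normalized_L1_le iD nD i))//.
  rewrite (_ : \int[tuple_power P m.+1]_x `|average D x| = 0) ?mulr0//.
  suff e0 : (\int[tuple_power P m.+1]_x `|(average D x)%:E| = 0)%E.
    by rewrite /Rintegral e0.
  apply/ae_eq_integral_abs => //.
    exact: measurable_int (Lfun_integrable1 (ltW q1) (Lq_average Dq)).
  by apply: ae_imply avD => x /= -> _.
have : (\int[P]_t `|(D i t)%:E| = 0)%E.
  rewrite (Rintegral_EFin (integrable_norm (iD i))); congr EFin.
  apply/eqP; rewrite eq_le; apply/andP; split; first exact: D0.
  by apply: Rintegral_ge0 => t _ /=.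
move/(ae_eq_integral_abs _ measurableT (measurable_int _ (iD i))).
by apply: ae_imply => t /(_ I) [] /eqP; rewrite subr_eq0 => /eqP.
Qed.

(** Testing the equations with the average itself shows that the integral of G times the average
    equals that of |average|^q; the rest is 1/p + 1/q = 1. *)
Lemma solution_energy G Phi : G \in Lfun (tuple_power P m.+1) p%:E ->
  (forall i, Phi i \in Lfun P q%:E) ->
  (forall i, {ae P, forall t, marg (dual Phi) i t = marg G i t}) ->
  p * \int[tuple_power P m.+1]_x energy p q (G x) (average Phi x) =
  \int[tuple_power P m.+1]_x (`|G x| `^ p) -
  \int[tuple_power P m.+1]_x (`|average Phi x| `^ q).
Proof.
move=> Gp Phiq PhiG.
have avq := Lq_average Phiq; have Fp := Lp_dual Phiq.
have iG := Lfun_powR_integrable (ltW p1) Gp.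
have iav := Lfun_powR_integrable (ltW q1) avq.
have iGav := Lfun_mul_integrable p1 q1 pq Gp avq.
have Gav : \int[tuple_power P m.+1]_x (G x * average Phi x) =
    \int[tuple_power P m.+1]_x (`|average Phi x| `^ q).
  rewrite -(eq_Rintegral_mul_average Fp Gp Phiq PhiG).
  by apply: eq_Rintegral => x _; rewrite signed_powerMr.
rewrite (_ : \int[tuple_power P m.+1]_x energy p q (G x) (average Phi x) =
  \int[tuple_power P m.+1]_x (p^-1 * `|G x| `^ p + q^-1 * `|average Phi x| `^ q -
    G x * average Phi x)); last first.
  by apply: eq_Rintegral => x _; rewrite /energy ![_ / _]mulrC.
have iG' := integrable_funZ p^-1 iG; have iav' := integrable_funZ q^-1 iav.
rewrite RintegralB//; last exact: integrable_funD.
rewrite RintegralD// !RintegralZl// Gav.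
have -> : q^-1 = 1 - p^-1 by rewrite -pq addrC addKr.
move: (\int[_]_x _) (\int[_]_x _) => B A.
have -> : p^-1 * A + (1 - p^-1) * B - B = p^-1 * (A - B) by ring.
by rewrite mulVKf// gt_eqF.
Qed.

End solution.

(** * The unit cube with Lebesgue measure *)

Theorem theorem2p5 (R : realType) (n : nat) (hn : (2 <= n)%N)
    (p q : R) (hp : 1 < p) (hq : q = p / (p - 1))
    (g : n.-tuple R -> R) (hg : g \in Lfun (lebesgue_cube R n) p%:E) :
  [/\ (exists Phi : 'I_n -> R -> R, is_solution p q g Phi),
      (forall Phi Psi : 'I_n -> R -> R,
         is_solution p q g Phi -> is_solution p q g Psi ->
         forall i : 'I_n, {ae @lebesgue01 R, forall t, Phi i t = Psi i t})
    & (forall Phi : 'I_n -> R -> R, is_solution p q g Phi ->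
         (\int[lebesgue_cube R n]_xi (`|average Phi xi| `^ (p / (p - 1)))%:E
            <= \int[lebesgue_cube R n]_xi (`|g xi| `^ p)%:E)%E
         /\ ((\int[lebesgue_cube R n]_xi (`|g xi| `^ p)%:E =
              \int[lebesgue_cube R n]_xi
                (`|average Phi xi| `^ (p / (p - 1)))%:E)%E <->
             {ae lebesgue_cube R n, forall xi,
                g xi = signed_power (p - 1)^-1 (average Phi xi)}))].
Proof.
have pB1 : 0 < p - 1 by rewrite subr_gt0.
have p0 : 0 < p by exact: lt_trans ltr01 hp.
have q1 : 1 < q by rewrite hq ltr_pdivlMr// mul1r ltrBlDr ltrDl.
(* With this exponent the integrand of the equations is the derivative of |.|^q / q at the
   average. *)
have qE : (p - 1)^-1 = q - 1 by rewrite hq; field; rewrite gt_eqF.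
have pq : p^-1 + q^-1 = 1 by rewrite hq; field; rewrite !gt_eqF.
rewrite -hq /is_solution qE.
case: n hn g hg => [//|m] _ g hg.
(* The constraints use extended-real integrals; integrability makes them equivalent to the
   real-valued ones. *)
have normE Phi : (forall i, Phi i \in Lfun (@lebesgue01 R) q%:E) ->
    (forall i : 'I_m.+1, (0 < i)%N -> (\int[@lebesgue01 R]_t (Phi i t)%:E = 0)%E) <->
    normalized (@lebesgue01 R) Phi.
  move=> Phiq; split=> [Phi0 i i0|nPhi i i0]; first by rewrite /Rintegral Phi0.
  rewrite Rintegral_EFin; last exact: Lfun_integrable1 (ltW q1) (Phiq i).
  by rewrite nPhi.
split.
- have [Phi [Phiq Phig nPhi]] := exists_solution hp q1 pq hg.
  by exists Phi; split => //; exact/normE.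
- move=> Phi Psi [Phiq Phig /(normE _ Phiq) nPhi] [Psiq Psig /(normE _ Psiq) nPsi].
  exact: (solution_unique hp q1 pq Phiq Psiq Phig Psig nPhi nPsi).
- move=> Phi [Phiq Phig _].
  have energyE := solution_energy hp q1 pq hg Phiq Phig.
  have avq := Lfun_average (ltW q1) Phiq.
  have iG := Lfun_powR_integrable (ltW hp) hg.
  have iav := Lfun_powR_integrable (ltW q1) avq.
  have iE := energy_integrable hp q1 pq hg avq.
  rewrite (Rintegral_EFin iG) (Rintegral_EFin iav) lee_fin -subr_ge0 -energyE.
  split.
    rewrite pmulr_rge0//; apply: Rintegral_ge0 => x _.
    exact: energy_ge0.
  (* Equality of the integrals means zero total energy, hence zero energy almost everywhere and the
     equality case of Young's inequality. Conversely, |g|^p and |average|^q then agree almost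
     everywhere. *)
  split=> [[] /eqP|gE].
    rewrite -subr_eq0 -energyE mulf_eq0 gt_eqF//= => /eqP E0.
    have : (\int[tuple_power (@lebesgue01 R) m.+1]_x
        `|(energy p q (g x) (average Phi x))%:E| = 0)%E.
      under eq_integral do rewrite /= (ger0_norm (energy_ge0 hp q1 pq _ _)).
      by rewrite (Rintegral_EFin iE) E0.
    move/(ae_eq_integral_abs _ measurableT (measurable_int _ iE)).
    by apply: ae_imply => x /(_ I) [] /(energy_eq0 hp q1 pq).
  rewrite -(Rintegral_EFin iG) -(Rintegral_EFin iav).
  apply: ae_eq_integral => //; [exact: measurable_int iG|exact: measurable_int iav|].
  by apply: ae_imply gE => x gx _; rewrite gx (powR_signed_power hp q1 pq).
Qed.
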